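(* Let $I=[0,T]$ be a bounded time interval and let $H$ be a separable Hilbert space. Let $r>0$ be a fixed real and let $f:H\to H$ be a Lipschitz function admitting at most a linear growth: there exists a constant $L>0$ with $\|f(x)\|\le L(1+\|x\|)$ for all $x\in H$. Let $a\in H$ and let $C_0$ be a nonempty closed subset of $H$ which, for every $t\in I$, is $(r,\,f(\cdot+ta)-a)$-prox-regular. Consider the set-valued map $C(\cdot)$ defined by $C(t)=C_0+ta$ for all $t\in I$. Then for all $u_0\in C_0$, the system $$\dot u(t)+\mathrm{N}(C(t),u(t))\ni f(u(t))\ \text{ for a.e. } t\in I,\qquad u(0)=u_0,$$ has one and only one absolutely continuous solution $u$, and for all $t\in I$, $u(t)\in C(t)$.
   Context: Hilbert spaces are real; the norm of $H$ is $\|\cdot\|$. Projection: for $C\subset H$ closed and $x\in H$, $P_C(x):=\{y\in C:\ \|x-y\|=d(x,C)\}$ (a possibly empty or multi-element set; when it is a singleton it is identified with its element). Proximal normal cone: for $x\in C$, $\mathrm{N}(C,x):=\{v\in H:\ \exists s>0,\ x\in P_C(x+sv)\}$. For $x\in C$ and $r>0$, $\Gamma^r(C,x):=\{v\in H:\ x\in P_C(x+rv)\}$. Directional prox-regularity: for a mapping $g:H\to H$, a closed set $C$ is $(r,g)$-prox-regular if for all $x\in C$ and all $s\in(0,r)$: (a) the projection $z:=P_C\left(x+s\frac{g(x)}{\|g(x)\|}\right)$ is well-defined (a single point); and (b) with $y:=x+s\frac{g(x)}{\|g(x)\|}$, one has $\frac{y-z}{\|y-z\|}\in\Gamma^r(C,z)$.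 By convention $\frac{v}{\|v\|}:=0$ if $v=0$. Here $f(\cdot+ta)-a$ denotes the map $x\mapsto f(x+ta)-a$. *)

(* Defs.v *)
From HB Require Import structures.
From mathcomp Require Import all_boot all_order all_algebra.
From mathcomp Require Import all_classical all_reals all_analysis.

Set Implicit Arguments.
Unset Strict Implicit.
Unset Printing Implicit Defensive.

Import Order.TTheory GRing.Theory Num.Theory.
Import numFieldNormedType.Exports.

Local Open Scope classical_set_scope.
Local Open Scope ring_scope.

(* A real Hilbert space is a [completeNormedModType R] together with a
   positive definite symmetric bilinear form inducing its norm. *)
Definition induces_norm (R : realType) (H : normedModType R)
    (dot : {dot H for idfun}) : Prop :=
  forall x : H, dot x x = `|x| ^+ 2.

Definition separable (T : topologicalType) : Prop :=
  exists2 D : set T, countable D & dense D.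

Section proximal.
Context {R : realType} {H : normedModType R}.
Implicit Types (C : set H) (x v a : H) (r : R).

(* [inf set0 = 0]: this is the usual distance only for nonempty [C]. *)
Definition dist_set x C : R := inf [set `|x - y| | y in C].

Definition proj C x : set H := [set y | C y /\ `|x - y| = dist_set x C].

(* Empty for [x] outside [C], since [proj C _] is included in [C]. *)
Definition prox_normal_cone C x : set H :=
  [set v | exists2 s : R, 0 < s & proj C (x + s *: v) x].

Definition Gamma r C x : set H := [set v | proj C (x + r *: v) x].

(* [direction 0 = 0]. *)
Definition direction v : H := `|v|^-1 *: v.

Definition dir_prox_regular r (g : H -> H) C : Prop :=
  closed C /\
  forall x (s : R), C x -> 0 < s < r ->
    let y := x + s *: direction (g x) in
    exists z : H, proj C y = [set z] /\ Gamma r C z (direction (y - z)).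

Definition translate C a : set H := [set x + a | x in C].

Definition absolutely_continuous (T : R) (u : R -> H) : Prop :=
  forall e : R, 0 < e -> exists2 d : R, 0 < d &
    forall (n : nat) (a b : 'I_n -> R),
      (forall i, 0 <= a i /\ a i <= b i /\ b i <= T) ->
      trivIset [set: 'I_n] (fun i => `]a i, b i[%classic) ->
      \sum_(i < n) (b i - a i) < d ->
      \sum_(i < n) `|u (b i) - u (a i)| < e.

(* Only the values of [u] between 0 and [T] matter: the end points, where the
   two-sided derivative sees values outside, form a negligible set. *)
Definition sweeping_solution (T : R) (C : R -> set H) (f : H -> H) (u0 : H)
    (u : R -> H) : Prop :=
  [/\ absolutely_continuous T u,
      {ae (@lebesgue_measure R), forall t : R, `[0, T]%classic t ->
        derivable u t 1 /\
        prox_normal_cone (C t) (u t) (f (u t) - derive1 u t)} &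
      u 0 = u0].

End proximal.

(* Main.v *)
Require Import Defs.
From HB Require Import structures.
From mathcomp Require Import all_boot all_order all_algebra.
From mathcomp Require Import all_classical all_reals all_analysis.
From mathcomp Require Import measurable_realfun ring lra.

(** Subtracting the translation, [v t = u t - t *: a] moves in the fixed set [C0]
   under the force [g t x = f (x + t *: a) - a], Lipschitz in both variables, minus
   a proximal normal. Directional prox-regularity controls only the normals that
   come from projecting [x + h *: g t x] for small [h]: they are supported by balls
   of radius [r] outside [C0]. The point is that no other normal ever acts.

   Uniqueness. Where a solution is differentiable, the normal [n = g - v'] is
   orthogonal to [v'], because both [v'] and [- v'] are tangent to [C0]. Hence the
   projection of [v t + h *: g] leaves [v t] with velocity [v'] as [h] decreases to
   [0], and the inequality satisfied by these projections passes to the limit: [n]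
   is a normal with the uniform constant [`|g| / (2 * r)] ([velocity_normal_bound],
   [solution_normal]). Normal components of two solutions are then hypomonotone,
   and the Gronwall inequality for absolutely continuous functions
   ([ac_nonincreasing], [ac_gronwall]) makes the solutions equal
   ([solution_unique]).

   Existence. The catching-up scheme follows the force for a time [h] and projects
   onto [C0]. Over a block of consecutive steps it satisfies, with errors that do
   not depend on [h], a variational inequality ([scheme_evi]), an energy
   inequality ([scheme_energy]) and a stability estimate under shifts of time
   ([scheme_shift]). The first one shows that the scheme is a Cauchy sequence as
   the step is halved ([scheme_compare]), and all three pass to the limit [v]
   ([sweeping_limit_exists]).

   That [v] is differentiable almost everywhere follows from these estimates
   alone. The first two give, for difference quotients [D s h] and [D s l] from the
   same time, the bound [`|D s h| ^+ 2 - `|D s l| ^+ 2] for their squared distance,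
   up to errors that vanish when [l] and [h / l] do. So right derivatives exist
   everywhere ([right_derivative]). The third one makes the right speed decrease up
   to a linear drift, so it has at most countably many jumps; at any other time the
   same comparison shows that left quotients tend to the right derivative
   ([differentiable_off_countable]). The variational inequality over intervals that
   shrink to a point is the differential inclusion ([right_deriv_evi]). *)

Import Order.TTheory GRing.Theory Num.Theory.
Import numFieldNormedType.Exports.

Local Open Scope classical_set_scope.
Local Open Scope ring_scope.

Set Implicit Arguments.
Unset Strict Implicit.
Unset Printing Implicit Defensive.

(** * The inner product *)

Section hilbert.
Context {R : realType} {H : normedModType R}.
Variables (dot : {dot H for idfun}) (hdot : induces_norm dot).
Implicit Types x y z : H.

Lemma dotC x y : dot x y = dot y x.
Proof. by rewrite (hermC dot x y) expr0 mul1r. Qed.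

Lemma dotDl x y z : dot (x + y) z = dot x z + dot y z.
Proof. by rewrite linearDl. Qed.

Lemma dotDr x y z : dot x (y + z) = dot x y + dot x z.
Proof. by rewrite linearDr. Qed.

Lemma dotBl x y z : dot (x - y) z = dot x z - dot y z.
Proof. by rewrite linearBl. Qed.

Lemma dotBr x y z : dot x (y - z) = dot x y - dot x z.
Proof. by rewrite linearBr. Qed.

Lemma dotZl (k : R) x y : dot (k *: x) y = k * dot x y.
Proof. by rewrite linearZl_LR. Qed.

Lemma dotZr (k : R) x y : dot x (k *: y) = k * dot x y.
Proof. by rewrite dotC dotZl dotC. Qed.

Lemma dotNl x y : dot (- x) y = - dot x y.
Proof. by rewrite linearNl. Qed.

Lemma dotNr x y : dot x (- y) = - dot x y.
Proof. by rewrite linearNr. Qed.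

Lemma dot0l x : dot 0 x = 0.
Proof. by rewrite linear0l. Qed.

Lemma dot0r x : dot x 0 = 0.
Proof. by rewrite linear0r. Qed.

Definition dotE := (dotDl, dotDr, dotBl, dotBr, dotZl, dotZr, dotNl, dotNr).

(** Reduces a linear identity between vectors, once expanded by [dotE], to an
   identity between scalars that [ring] proves. *)
Lemma dot_inj x y : (forall z, dot x z = dot y z) -> x = y.
Proof.
move=> xy; apply/subr0_eq/normr0_eq0/eqP; rewrite -sqrf_eq0 -hdot dotBl xy.
by rewrite subrr.
Qed.

Lemma sqr_normD x y : `|x + y| ^+ 2 = `|x| ^+ 2 + 2 * dot x y + `|y| ^+ 2.
Proof. by rewrite -!hdot !dotE (dotC y x); ring. Qed.

Lemma sqr_normB x y : `|x - y| ^+ 2 = `|x| ^+ 2 - 2 * dot x y + `|y| ^+ 2.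
Proof. by rewrite -!hdot !dotE (dotC y x); ring. Qed.

Lemma dot_polar x y : dot x y = 2^-1 * (`|x + y| ^+ 2 - `|x| ^+ 2 - `|y| ^+ 2).
Proof. by rewrite sqr_normD; field. Qed.

Lemma dot_le x y : dot x y <= `|x| * `|y|.
Proof.
have [->|x0] := eqVneq x 0; first by rewrite dot0l normr0 mul0r.
have [->|y0] := eqVneq y 0; first by rewrite dot0r normr0 mulr0.
have xp : 0 < `|x| by rewrite normr_gt0.
have yp : 0 < `|y| by rewrite normr_gt0.
have := sqr_ge0 (`| `|y| *: x - `|x| *: y|).
rewrite sqr_normB !dotE !normrZ !normr_id => h.
have {h} : 0 <= 2 * (`|x| * `|y|) * (`|x| * `|y| - dot x y) by lra.
by rewrite pmulr_rge0 ?subr_ge0// !mulr_gt0.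
Qed.

(** By polarization, continuity of the inner product is that of the norm. *)
Lemma cvg_dot (T : Type) (F : set_system T) {FF : Filter F}
    (f g : T -> H) (a b : H) :
  f t @[t --> F] --> a -> g t @[t --> F] --> b ->
  dot (f t) (g t) @[t --> F] --> dot a b.
Proof.
move=> fa gb; rewrite dot_polar; under eq_fun do rewrite dot_polar.
have sq (u : T -> H) c : u t @[t --> F] --> c ->
    (`|u t| ^+ 2 : R^o) @[t --> F] --> `|c| ^+ 2.
  move=> uc; rewrite expr2; under eq_fun do rewrite expr2.
  by apply: cvgM; apply: cvg_norm.
apply: cvgMr; apply: cvgB; last exact: sq.
by apply: cvgB; apply: sq => //; apply: cvgD.
Qed.

End hilbert.

(** * Metric projections *)

Section projection.
Context {R : realType} {H : normedModType R}.
Variables (dot : {dot H for idfun}) (hdot : induces_norm dot).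
Implicit Types (C : set H) (x y z c : H) (r s h : R).

Lemma dist_set_le C x c : C c -> dist_set x C <= `|x - c|.
Proof.
move=> Cc; apply: ge_inf; last by exists c.
by exists 0 => _ [y _ <-].
Qed.

Lemma le_norm_dot x y : `|x| <= `|x + y| <-> 0 <= 2 * dot x y + `|y| ^+ 2.
Proof.
rewrite -ler_sqr ?nnegrE// (sqr_normD hdot).
by split; lra.
Qed.

(** The ball of radius [s * `|v|] centred at [x + s *: v] has [x] on its boundary;
   that no point of [C] is inside it is a quadratic inequality in [c - x]. *)
Lemma proj_normal C x v s : 0 < s -> C x ->
  Defs.proj C (x + s *: v) x <->
  forall c, C c -> dot v (c - x) <= (2 * s)^-1 * `|c - x| ^+ 2.
Proof.
move=> s0 Cx.
have e c : x + s *: v - c = s *: v + (x - c) by rewrite addrAC addrC.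
have i c : `|s *: v| <= `|x + s *: v - c| <->
    dot v (c - x) <= (2 * s)^-1 * `|c - x| ^+ 2.
  rewrite e le_norm_dot dotZl -(distrC c) -(opprB c) dotNr.
  rewrite -[X in _ <-> is_true X]subr_ge0.
  rewrite -[X in _ <-> is_true X](pmulr_rge0 _ (_ : 0 < 2 * s)) ?mulr_gt0//.
  have -> : 2 * s * ((2 * s)^-1 * `|c - x| ^+ 2 - dot v (c - x)) =
    2 * (s * - dot v (c - x)) + `|c - x| ^+ 2 by field; lra.
  by [].
have ex : `|x + s *: v - x| = `|s *: v| by rewrite addrAC subrr add0r.
split=> [[_ d] c Cc|dn].
  by apply/i; rewrite -ex d; exact: dist_set_le.
split=> //; rewrite ex; apply/eqP; rewrite eq_le; apply/andP; split.
  apply: lb_le_inf; first by exists `|x + s *: v - x|, x.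
  by move=> _ [c Cc <-]; apply/i; exact: dn.
by rewrite -ex; exact: dist_set_le.
Qed.

Lemma directionK x : `|x| *: direction x = x.
Proof.
rewrite /direction; have [->|x0] := eqVneq x 0; first by rewrite !scaler0.
by rewrite scalerA divff ?scale1r// normr_eq0.
Qed.

(** Any choice of a nearest point will do: under directional prox-regularity there
   is exactly one. *)
Definition catch_up C (v : H -> H) h x : H := xget x (Defs.proj C (x + h *: v x)).

(** Directional prox-regularity is normalized by unit vectors; multiplying by the
   distance to the projection, which is at most [h * `|v x|] because [x] is in
   [C], makes it an inequality of first order in [h]. *)
Lemma catch_upP C r v h x (z := catch_up C v h x) :
  0 < r -> dir_prox_regular r v C -> C x -> 0 < h -> h * `|v x| < r ->
  [/\ C z, forall c, C c -> `|x + h *: v x - z| <= `|x + h *: v x - c| &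
   forall c, C c ->
     dot (x + h *: v x - z) (c - z) <= h * (`|v x| / (2 * r)) * `|c - z| ^+ 2].
Proof.
move=> r0 [_ reg] Cx h0 hr.
have [vx0|vx0] := eqVneq (v x) 0.
  have P : Defs.proj C (x + h *: v x) x.
    apply/proj_normal => // c _; rewrite vx0 dot0l.
    by rewrite mulr_ge0 ?sqr_ge0// invr_ge0 mulr_ge0// ltW.
  have [Cz dz] : Defs.proj C (x + h *: v x) z by rewrite /z /catch_up; exact: xgetI P.
  have := P.2; rewrite -dz vx0 scaler0 addr0 subrr normr0 => /esym/normr0_eq0.
  move=> /subr0_eq <-; split => // [c Cc|c Cc]; rewrite subrr ?normr0//.
  by rewrite dot0l !(mulr0, mul0r).
have n0 : 0 < `|v x| by rewrite normr_gt0.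
have := reg x (h * `|v x|) Cx; rewrite mulr_gt0// => /(_ hr).
rewrite /= -scalerA directionK => -[w [Pw Gw]].
have zw : z = w by rewrite /z /catch_up Pw; apply: (@xgetI _ x [set w] w).
have [Cw dw] : Defs.proj C (x + h *: v x) w by rewrite Pw.
rewrite zw; split => // [c Cc|c Cc]; first by rewrite dw; exact: dist_set_le.
move: Gw => /(proj1 (proj_normal _ r0 Cw)) /(_ c Cc) Gw.
have : `|x + h *: v x - w| <= h * `|v x|.
  rewrite dw (le_trans (dist_set_le _ Cx))// addrAC subrr add0r normrZ.
  by rewrite gtr0_norm.
rewrite -{2}(directionK (_ - w)) dotZl => nl.
apply: (le_trans (ler_wpM2l (normr_ge0 _) Gw)).
rewrite [leRHS](_ : _ = h * `|v x| * ((2 * r)^-1 * `|c - w| ^+ 2)); last by ring.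
by rewrite ler_wpM2r// mulr_ge0 ?sqr_ge0// invr_ge0 mulr_ge0// ltW.
Qed.

End projection.

(** * Estimates for discrete motions *)

Section discrete_gronwall.
Context {R : realType}.
Implicit Types c d s t x y : R.

Lemma gronwall_step c d s t x y : 0 < c -> 0 <= d -> 0 <= t ->
  x <= d / c * (expR (c * s) - 1) -> y <= (1 + c * t) * x + d * t ->
  y <= d / c * (expR (c * (s + t)) - 1).
Proof.
move=> c0 d0 t0 hx hy; apply: (le_trans hy).
have ct : 0 <= 1 + c * t by rewrite addr_ge0// mulr_ge0// ltW.
have h1 := ler_wpM2l ct hx.
have e1 := expR_ge1Dx (c * t).
have dc : 0 <= d / c by rewrite divr_ge0// ltW.
have h2 : d / c * (expR (c * s) * (1 + c * t)) <= d / c * (expR (c * s) * expR (c * t)).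
  by rewrite ler_wpM2l// ler_wpM2l// expR_ge0.
rewrite [c * (s + t)]mulrDr expRD.
have -> : d * t = d / c * (c * t) by field; lra.
by move: h1 h2; set p := d / c; set q := expR _; set w := expR _; lra.
Qed.

End discrete_gronwall.

Lemma time_succ (R : realType) (h : R) m : m.+1%:R * h = m%:R * h + h.
Proof. by rewrite -natr1 mulrDl mul1r. Qed.

Section scheme.
Context {R : realType} {H : normedModType R}.
Variables (dot : {dot H for idfun}) (hdot : induces_norm dot).
Variables (C : set H) (g : R -> H -> H) (k S L M K : R).
Hypotheses (k0 : 0 < k) (S0 : 0 < S) (L0 : 0 <= L) (M0 : 0 <= M) (K0 : 0 <= K).
Hypothesis g_lip : forall s t x y, `|g t x - g s y| <= k * (`|x - y| + `|t - s|).

(** What the estimates need from the catching-up algorithm of step [h]. The vector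
   [h *: g (j%:R * h) (Y j) - (Y j.+1 - Y j)] is the displacement that the
   projection onto [C] removes at step [j]. *)
Record catching_up (h : R) (N : nat) (Y : nat -> H) : Prop := CatchingUp {
  step_gt0 : 0 < h ;
  step_le : N%:R * h <= S ;
  step_mem : forall j, (j <= N)%N -> C (Y j) ;
  step_speed : forall j, (j < N)%N -> `|Y j.+1 - Y j| <= L * h ;
  step_normal : forall j, (j < N)%N ->
    `|h *: g (j%:R * h) (Y j) - (Y j.+1 - Y j)| <= M * h ;
  step_prox : forall j c, (j < N)%N -> C c ->
    dot (h *: g (j%:R * h) (Y j) - (Y j.+1 - Y j)) (c - Y j.+1) <=
    h * K * `|c - Y j.+1| ^+ 2 }.

(** A common bound for the second-order errors in the estimates over blocks of
   consecutive steps; it does not depend on the step. *)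
Definition err : R :=
  2 * K * L + K * L ^+ 2 * S + M * L + k * (L + 1) * (L + 1) + K * L ^+ 2.

Lemma err_ge0 : 0 <= err.
Proof.
by rewrite /err !addr_ge0// ?mulr_ge0// ?sqr_ge0// ?addr_ge0// ltW.
Qed.

Section one_mesh.
Variables (h : R) (N : nat) (Y : nat -> H) (Yh : catching_up h N Y).

Let h0 : 0 < h. Proof. exact: step_gt0 Yh. Qed.

Lemma scheme_lip i m : (i + m <= N)%N -> `|Y (i + m)%N - Y i| <= L * (m%:R * h).
Proof.
elim: m => [|m IH] mN; first by rewrite addn0 subrr normr0 mul0r mulr0.
rewrite addnS in mN *.
have := step_speed Yh mN; have := IH (ltnW mN).
have := ler_normD (Y (i + m).+1 - Y (i + m)%N) (Y (i + m)%N - Y i).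
by rewrite addrA subrK time_succ; lra.
Qed.

Lemma scheme_time m : (m <= N)%N -> m%:R * h <= S.
Proof.
by move=> mN; apply: le_trans (step_le Yh); rewrite ler_wpM2r ?ler_nat// ltW.
Qed.

Lemma scheme_force i m : (i + m <= N)%N ->
  `|g (i%:R * h) (Y i) - g ((i + m)%N%:R * h) (Y (i + m)%N)| <=
  k * (L + 1) * (m%:R * h).
Proof.
move=> mN; apply: (le_trans (g_lip _ _ _ _)).
rewrite -mulrA ler_wpM2l ?(ltW k0)// mulrDl mul1r distrC lerD ?scheme_lip//.
rewrite natrD mulrDl opprD addrA subrr sub0r normrN ger0_norm//.
by rewrite mulr_ge0// ltW.
Qed.

(** Every step obeys a variational inequality at its own end point and with its
   own force. Moving the inequalities of a block to the position and the force at
   its beginning costs, per step, [h] times the elapsed time, so the sum is of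
   second order in the duration of the block. *)
Lemma scheme_evi i m c : (i + m <= N)%N -> C c ->
  dot ((m%:R * h) *: g (i%:R * h) (Y i) - (Y (i + m)%N - Y i)) (c - Y i) <=
  (m%:R * h) * K * `|c - Y i| ^+ 2 + err * (1 + `|c - Y i|) * (m%:R * h) ^+ 2.
Proof.
move=> + Cc; elim: m => [|m IH] mN.
  by rewrite mul0r addn0 subrr scale0r subr0 dot0l; lra.
rewrite addnS in mN *; set j := (i + m)%N in mN IH *.
have {}IH := IH (ltnW mN).
have lS : m.+1%:R * h <= S.
  by apply: scheme_time; apply: leq_trans mN; rewrite ltnS leq_addl.
have gf := scheme_force (ltnW mN : i + m <= N)%N.
have nM := step_normal Yh mN; have pr := step_prox Yh mN Cc.
have wl : `|Y j.+1 - Y i| <= L * (m.+1%:R * h).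
  by rewrite /j -addnS; apply: scheme_lip; rewrite addnS.
rewrite time_succ in lS wl *.
have l0 : 0 <= m%:R * h by rewrite mulr_ge0// ltW.
move: l0 lS gf wl IH; rewrite -/j; set l := m%:R * h => l0 lS gf wl IH.
set gi := g _ (Y i) in gf IH *; set gj := g _ (Y j) in gf nM pr.
set n := h *: gj - _ in nM pr.
have -> : (l + h) *: gi - (Y j.+1 - Y i) =
    (l *: gi - (Y j - Y i)) + n + h *: (gi - gj).
  by apply: (dot_inj hdot) => z; rewrite /n !dotE; ring.
rewrite 2!dotDl [dot (h *: _) _]dotZl.
have -> : dot n (c - Y i) = dot n (c - Y j.+1) + dot n (Y j.+1 - Y i).
  by rewrite !dotE; ring.
have p1 := dot_le hdot n (Y j.+1 - Y i).
have p2 := dot_le hdot (gi - gj) (c - Y i).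
have p3 : `|c - Y j.+1| <= `|c - Y i| + `|Y j.+1 - Y i|.
  by rewrite -[X in _ <= _ + X]normrN opprB (le_trans _ (ler_normD _ _))// subrKA.
have {}p1 : dot n (Y j.+1 - Y i) <= M * h * (L * (l + h)).
  by apply: (le_trans p1); rewrite ler_pM.
have {}p2 : h * dot (gi - gj) (c - Y i) <= h * (k * (L + 1) * l * `|c - Y i|).
  by rewrite ler_wpM2l ?(ltW h0)// (le_trans p2)// ler_wpM2r.
have Rge0 : 0 <= `|c - Y i| := normr_ge0 _.
have sge0 := normr_ge0 (c - Y j.+1).
move: IH p1 p2 p3 wl pr Rge0 sge0.
set R0 := `|c - Y i|; set s := `|c - Y j.+1|; set w := `|Y j.+1 - Y i|.
set d1 := dot _ (c - Y i); set d2 := dot n (c - Y j.+1).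
set d3 := dot n (Y j.+1 - Y i); set d4 := dot (gi - gj) _.
move=> IH p1 p2 p3 wl pr Rge0 sge0.
have ss : s ^+ 2 <= R0 ^+ 2 + (2 * R0 * L + L ^+ 2 * S) * (l + h).
  have sR : s <= R0 + L * (l + h) by lra.
  have := lerXn2r 2 sge0 (le_trans sge0 sR) sR.
  have := ler_wpM2l (mulr_ge0 (sqr_ge0 L) (addr_ge0 l0 (ltW h0))) lS.
  by lra.
have {}ss := ler_wpM2l (mulr_ge0 (ltW h0) K0) ss.
have hl : 0 <= h * (l + h) by rewrite mulr_ge0 ?addr_ge0 ?(ltW h0).
have e1 : K * (2 * R0 * L + L ^+ 2 * S) + M * L + k * (L + 1) * R0 <=
    err * (1 + R0).
  have kL : 0 <= k * (L + 1) by rewrite mulr_ge0 ?addr_ge0 ?(ltW k0).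
  have a1 := mulr_ge0 K0 L0; have a2 := mulr_ge0 K0 (sqr_ge0 L).
  have a3 := mulr_ge0 a2 (ltW S0); have a4 := mulr_ge0 M0 L0.
  have a5 := mulr_ge0 kL L0.
  have b3 := mulr_ge0 a3 Rge0; have b4 := mulr_ge0 a4 Rge0.
  have b5 := mulr_ge0 a5 Rge0; have b2 := mulr_ge0 a2 Rge0.
  by rewrite /err; lra.
have {}e1 := ler_wpM2l hl e1.
have e2 := mulr_ge0 (mulr_ge0 err_ge0 (addr_ge0 ler01 Rge0)) (mulr_ge0 l0 (ltW h0)).
have l1 : h * (k * (L + 1) * l * R0) <= h * (k * (L + 1) * (l + h) * R0).
  rewrite ler_wpM2l ?(ltW h0)// ler_wpM2r// ler_wpM2l// ?lerDl ?(ltW h0)//.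
  by rewrite mulr_ge0 ?addr_ge0 ?(ltW k0).
by lra.
Qed.

(** Tested with the position before the step, the variational inequality says that
   the removed displacement hardly opposes the motion, hence that the squared
   speed is, up to small errors, at most the power of the force. The parameter
   [lam] replaces the Cauchy-Schwarz inequality for sums: in this form the estimate
   is additive over the steps, and it is sharp when [lam] is the mean speed of the
   block. *)
Lemma scheme_energy i m (lam : R) : (i + m <= N)%N -> 0 <= lam ->
  2 * lam * `|Y (i + m)%N - Y i| <= lam ^+ 2 * (m%:R * h) +
    dot (g (i%:R * h) (Y i)) (Y (i + m)%N - Y i) + err * (m%:R * h) ^+ 2.
Proof.
move=> + lam0; elim: m => [|m IH] mN.
  rewrite addn0 subrr normr0 dot0r !mul0r mulr0.
  by rewrite expr0n/= !mulr0 !addr0.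
rewrite addnS in mN *; set j := (i + m)%N in mN IH *.
have {}IH := IH (ltnW mN).
have gf := scheme_force (ltnW mN : i + m <= N)%N.
have := step_prox Yh mN (step_mem Yh (ltnW mN)); have := step_speed Yh mN.
rewrite (time_succ _ m).
have l0 : 0 <= m%:R * h by rewrite mulr_ge0// ltW.
move: l0 gf IH; rewrite -/j; set l := m%:R * h => l0 gf IH.
set gi := g _ (Y i) in gf IH *; set gj := g _ (Y j) in gf *.
rewrite (distrC (Y j)) => sp pr.
have {}pr : `|Y j.+1 - Y j| ^+ 2 <= h * dot gj (Y j.+1 - Y j) +
    h * K * `|Y j.+1 - Y j| ^+ 2.
  move: pr; rewrite -[Y j - _]opprB dotNr dotBl dotZl hdot; lra.
have p2 : dot (gj - gi) (Y j.+1 - Y j) <= k * (L + 1) * l * (L * h).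
  apply: (le_trans (dot_le hdot _ _)); rewrite (distrC gj).
  by rewrite ler_pM.
have w1 := ler_normD (Y j.+1 - Y j) (Y j - Y i).
rewrite subrKA in w1.
have -> : dot gi (Y j.+1 - Y i) = dot gi (Y j - Y i) + dot gi (Y j.+1 - Y j).
  by rewrite !dotE; ring.
rewrite dotBl in p2.
have d0 := normr_ge0 (Y j.+1 - Y j).
move: w1 pr p2 sp IH d0.
set w := `|Y j.+1 - Y i|; set v := `|Y j - Y i|; set d := `|Y j.+1 - Y j|.
set d1 := dot gi (Y j - Y i); set d2 := dot gj _; set d3 := dot gi _.
move=> w1 pr p2 sp IH d0.
(* [2 * lam * e <= lam ^+ 2 + e ^+ 2] for the speed [e] of the last step. *)
pose e := d / h.
have dE : d = h * e by rewrite /e mulrCA divff ?mulr1// gt_eqF.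
have e0 : 0 <= e by rewrite /e divr_ge0// ltW.
have eL : e <= L by rewrite /e ler_pdivrMr.
have {}pr : h * e ^+ 2 <= d2 + K * h ^+ 2 * L ^+ 2.
  have e2 : e ^+ 2 <= L ^+ 2 by rewrite lerXn2r ?nnegrE.
  have := ler_wpM2l (mulr_ge0 K0 (sqr_ge0 h)) e2.
  move: pr; rewrite dE => pr.
  have {}pr : h * (h * e ^+ 2) <= h * (d2 + K * h ^+ 2 * e ^+ 2) by lra.
  by move: pr; rewrite (ler_pM2l h0); lra.
have am := mulr_ge0 (ltW h0) (sqr_ge0 (lam - e)).
have lw := ler_wpM2l (mulr_ge0 (ler0n R 2) lam0) w1.
have lh := mulr_ge0 l0 (ltW h0).
have kL : 0 <= k * (L + 1) by rewrite mulr_ge0 ?addr_ge0 ?(ltW k0).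
have ehl : (k * (L + 1) * L + K * L ^+ 2) * (h * (l + h)) <= err * (h * (l + h)).
  rewrite ler_wpM2r ?mulr_ge0 ?addr_ge0 ?(ltW h0)//.
  have a1 := mulr_ge0 K0 L0; have a2 := mulr_ge0 K0 (sqr_ge0 L).
  have a3 := mulr_ge0 a2 (ltW S0); have a4 := mulr_ge0 M0 L0.
  by rewrite /err; lra.
have x1 := mulr_ge0 err_ge0 lh.
have x2 := mulr_ge0 (mulr_ge0 kL L0) (sqr_ge0 h).
have x3 := mulr_ge0 (mulr_ge0 K0 (sqr_ge0 L)) lh.
rewrite dE in lw p2.
by lra.
Qed.

(** The motion and its translate in time by [m] steps are two motions in [C]; as
   removed displacements are hypomonotone, the two separate at most at a rate
   proportional to [m%:R * h]. *)
Lemma scheme_shift i p m : (i + p + m <= N)%N ->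
  `|Y (i + p + m)%N - Y (i + p)%N| <=
  `|Y (i + m)%N - Y i| + err * (m%:R * h) * (p%:R * h).
Proof.
elim: p => [|p IH] pN; first by rewrite !addn0 mul0r mulr0 addr0.
rewrite addnS addSn in pN *; have {}IH := IH (ltnW pN).
have jN : (i + p < N)%N by apply: leq_ltn_trans pN; rewrite leq_addr.
set j := (i + p)%N in pN IH jN *.
have sx := step_prox Yh pN (step_mem Yh jN).
have sy := step_prox Yh jN (step_mem Yh pN).
have gf := g_lip (j%:R * h) ((j + m)%N%:R * h) (Y (j + m)%N) (Y j).
have tm : `|(j + m)%N%:R * h - j%:R * h| = m%:R * h.
  by rewrite natrD mulrDl addrAC subrr add0r ger0_norm// mulr_ge0// ltW.
rewrite tm in gf.
have z1 : `|Y (j + m)%N - Y j| <= L * (m%:R * h) by apply: scheme_lip; exact: ltnW.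
have z2 : `|Y (j + m).+1 - Y j.+1| <= L * (m%:R * h).
  by rewrite -addSn; apply: scheme_lip; rewrite addSn.
rewrite (time_succ _ p).
have l0 : 0 <= m%:R * h by rewrite mulr_ge0// ltW.
move: l0 gf z1 z2 IH; set l := m%:R * h => l0 gf z1 z2 IH.
set gx := g _ (Y (j + m)%N) in gf sx; set gy := g _ (Y j) in gf sy.
rewrite (distrC (Y j.+1)) in sx.
have pg := dot_le hdot (gx - gy) (Y (j + m).+1 - Y j.+1).
have pz := dot_le hdot (Y (j + m)%N - Y j) (Y (j + m).+1 - Y j.+1).
have key : `|Y (j + m).+1 - Y j.+1| ^+ 2 =
    dot (Y (j + m)%N - Y j) (Y (j + m).+1 - Y j.+1) +
    h * dot (gx - gy) (Y (j + m).+1 - Y j.+1) +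
    dot (h *: gx - (Y (j + m).+1 - Y (j + m)%N)) (Y j.+1 - Y (j + m).+1) +
    dot (h *: gy - (Y j.+1 - Y j)) (Y (j + m).+1 - Y j.+1).
  by rewrite -hdot !dotE; ring.
have g0 := normr_ge0 (gx - gy).
move: gf pg pz key z1 z2 IH sx sy (normr_ge0 (Y (j + m).+1 - Y j.+1)) g0.
set z' := `|Y (j + m).+1 - Y j.+1|; set z := `|Y (j + m)%N - Y j|.
set G := `|gx - gy|.
set d1 := dot (gx - gy) _; set d2 := dot (Y (j + m)%N - Y j) _.
set d3 := dot (h *: gx - _) _; set d4 := dot (h *: gy - _) _.
move=> gf pg pz key z1 z2 IH sx sy z0 g0.
have [z'0|z'0] := eqVneq z' 0.
  have ph : 0 <= p%:R * h + h by rewrite addr_ge0 ?mulr_ge0 ?(ltW h0).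
  by rewrite z'0 addr_ge0 ?normr_ge0// mulr_ge0// mulr_ge0// err_ge0.
have {z'0}zp : 0 < z' by rewrite lt_neqAle eq_sym z'0.
have {}pg : h * d1 <= h * (k * (L + 1) * l * z').
  rewrite ler_wpM2l ?(ltW h0)// (le_trans pg)// ler_wpM2r// (le_trans gf)//.
  by rewrite -mulrA ler_wpM2l ?(ltW k0)//; lra.
have zz : h * K * z' ^+ 2 <= h * K * (L * l) * z'.
  have -> : h * K * z' ^+ 2 = h * K * z' * z' by ring.
  by rewrite ler_wpM2r ?(ltW zp)// ler_wpM2l// mulr_ge0 ?(ltW h0).
have : z' * z' <= (z + h * l * (k * (L + 1) + 2 * K * L)) * z' by lra.
rewrite ler_pM2r// => zb.
have eb : (k * (L + 1) + 2 * K * L) * (h * l) <= err * (h * l).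
  rewrite ler_wpM2r ?mulr_ge0 ?(ltW h0)//.
  have kL : 0 <= k * (L + 1) by rewrite mulr_ge0 ?addr_ge0 ?(ltW k0).
  have a2 := mulr_ge0 K0 (sqr_ge0 L); have a5 := mulr_ge0 kL L0.
  have a3 := mulr_ge0 a2 (ltW S0); have a4 := mulr_ge0 M0 L0.
  by rewrite /err; lra.
by lra.
Qed.


End one_mesh.

(** Rate and amplitude in the Gronwall inequality between two meshes. *)
Definition mesh_rate : R := 2 * k + 4 * K + 4 * err * S.
Definition mesh_err : R := (8 * err + 4 * L ^+ 2) / mesh_rate * expR (mesh_rate * S).

(** One step on the coarse mesh and [q] steps on the fine one obey [scheme_evi] over
   the same duration; testing each with the position of the other bounds the
   growth of the squared distance, with an error of second order in the coarse
   step, which accumulates to the first order. *)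
Lemma scheme_compare h q N X Y : (0 < q)%N ->
  catching_up (q%:R * h) N X -> catching_up h (N * q) Y -> X 0%N = Y 0%N ->
  forall j, (j <= N)%N ->
    `|X j - Y (j * q)%N| ^+ 2 <= mesh_err * (q%:R * h).
Proof.
move=> q0 Xh Yh XY0.
have h0 := step_gt0 Yh; have n0 := step_gt0 Xh.
have e0 := err_ge0.
have c0 : 0 < mesh_rate.
  rewrite /mesh_rate; have := mulr_ge0 e0 (ltW S0); have := k0; have := K0; lra.
set n := q%:R * h in Xh n0 *.
have d0 : 0 <= (8 * err + 4 * L ^+ 2) * n.
  by rewrite mulr_ge0 ?(ltW n0)// addr_ge0// mulr_ge0// sqr_ge0.
suff E j : (j <= N)%N -> `|X j - Y (j * q)%N| ^+ 2 <=
    (8 * err + 4 * L ^+ 2) * n / mesh_rate * (expR (mesh_rate * (j%:R * n)) - 1).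
  move=> j jN; apply: (le_trans (E j jN)).
  rewrite [leRHS](_ : _ = (8 * err + 4 * L ^+ 2) * n / mesh_rate *
    expR (mesh_rate * S)); last by rewrite /mesh_err; ring.
  rewrite ler_wpM2l ?divr_ge0 ?(ltW c0)//.
  have jS := scheme_time Xh jN.
  have : expR (mesh_rate * (j%:R * n)) <= expR (mesh_rate * S).
    by rewrite ler_expR ler_wpM2l ?(ltW c0).
  lra.
elim: j => [|j IH] jN.
  by rewrite mul0n XY0 subrr normr0 expr0n/= mul0r mulr0 expR0 subrr mulr0.
have {}IH := IH (ltnW jN).
have nS : n <= S.
  by have := scheme_time Xh (leq_ltn_trans (leq0n j) jN); rewrite mul1r.
have jq : (j * q + q <= N * q)%N by rewrite addnC -mulSn leq_mul2r jN orbT.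
have Xj : (j + 1 <= N)%N by rewrite addn1.
have CX := step_mem Xh (ltnW jN).
have CY : C (Y (j * q)%N) by apply: (step_mem Yh); rewrite leq_mul2r (ltnW jN) orbT.
have bX := scheme_evi Xh Xj CY; have bY := scheme_evi Yh jq CX.
have lX := scheme_lip Xh Xj; have lY := scheme_lip Yh jq.
rewrite addn1 mul1r in bX lX.
rewrite -/n in bY lY.
have -> : (j.+1 * q)%N = (j * q + q)%N by rewrite mulSn addnC.
rewrite (time_succ n j); apply: (gronwall_step c0 d0 (ltW n0) IH).
have tj : (j * q)%N%:R * h = j%:R * n by rewrite natrM /n mulrA.
rewrite tj in bY.
have := g_lip (j%:R * n) (j%:R * n) (X j) (Y (j * q)%N).
rewrite subrr normr0 addr0.
move: bX bY lX lY; set x := X j; set y := Y (j * q)%N; set x' := X j.+1.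
set y' := Y (j * q + q)%N; set gx := g _ x; set gy := g _ y.
move=> bX bY lX lY gl.
have pg := dot_le hdot (gx - gy) (x - y).
have key : `|x' - y'| ^+ 2 = `|x - y| ^+ 2 + 2 * (n * dot (gx - gy) (x - y) +
   dot (n *: gx - (x' - x)) (y - x) + dot (n *: gy - (y' - y)) (x - y)) +
   `|(x' - x) - (y' - y)| ^+ 2.
  rewrite -!hdot !dotE (dotC dot y' x) (dotC dot x' x) (dotC dot y x).
  rewrite (dotC dot y x') (dotC dot y' y) (dotC dot y' x').
  by ring.
have sp : `|(x' - x) - (y' - y)| ^+ 2 <= (2 * L * n) ^+ 2.
  have le2 : `|(x' - x) - (y' - y)| <= 2 * L * n.
    by apply: (le_trans (ler_normB _ _)); lra.
  by apply: lerXn2r; rewrite ?nnegrE// (le_trans _ le2).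
rewrite (distrC y) in bX.
move: bX bY pg gl key sp (normr_ge0 (x - y)).
set w := `|x - y|; set d1 := dot (gx - gy) _; set d2 := dot _ (y - x).
set d3 := dot (_ - (y' - y)) _; set G := `|gx - gy|.
move=> bX bY pg gl key sp w0.
have {}pg : n * d1 <= n * (k * w ^+ 2).
  rewrite ler_wpM2l ?(ltW n0)// (le_trans pg)// expr2 mulrA ler_wpM2r//.
have w1 : 1 + w <= 2 + w ^+ 2 by have := sqr_ge0 (w - 1); have := sqr_ge0 w; lra.
have {}w1 := ler_wpM2l (mulr_ge0 e0 (sqr_ge0 n)) w1.
have {}nS := ler_wpM2l (mulr_ge0 (mulr_ge0 e0 (ltW n0)) (sqr_ge0 w)) nS.
rewrite key /mesh_rate.
by lra.
Qed.

End scheme.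

(** * The catching-up scheme *)

Section catching_up_exists.
Context {R : realType} {H : normedModType R}.
Variables (dot : {dot H for idfun}) (hdot : induces_norm dot).
Variables (C : set H) (g : R -> H -> H) (r k S : R) (u0 : H).
Hypotheses (r0 : 0 < r) (k0 : 0 < k) (S0 : 0 < S) (Cu0 : C u0).
Hypothesis g_reg : forall t, dir_prox_regular r (g t) C.
Hypothesis g_lip : forall s t x y, `|g t x - g s y| <= k * (`|x - y| + `|t - s|).

Fixpoint scheme (h : R) (j : nat) : H :=
  if j is i.+1 then catch_up C (g (i%:R * h)) h (scheme h i) else u0.

Definition initial_force : R := `|g 0 u0| + k * S.
Definition force_bound : R := initial_force * expR (2 * k * S).

Lemma initial_force_gt0 : 0 < initial_force.
Proof. by rewrite /initial_force ltr_wpDl// mulr_gt0. Qed.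

Lemma force_bound_gt0 : 0 < force_bound.
Proof. by rewrite mulr_gt0 ?initial_force_gt0 ?expR_gt0. Qed.

Lemma force_le t x : 0 <= t <= S -> `|g t x| <= initial_force + k * `|x - u0|.
Proof.
move=> /andP[t0 tS]; have := g_lip 0 t x u0.
rewrite subr0 (ger0_norm t0) => gl.
have := ler_normD (g t x - g 0 u0) (g 0 u0); rewrite subrK /initial_force.
by have := ler_wpM2l (ltW k0) tS; lra.
Qed.

(** A step moves by at most [2 * h] times the force, and the force grows linearly,
   so the discrete Gronwall inequality bounds both as long as every projection
   is within reach of the prox-regularity. *)
Lemma scheme_bounds h j : 0 < h -> h * force_bound < r -> j%:R * h <= S ->
  [/\ C (scheme h j),
    `|scheme h j - u0| <= 2 * initial_force / (2 * k) * (expR (2 * k * (j%:R * h)) - 1)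
    & `|g (j%:R * h) (scheme h j)| <= force_bound].
Proof.
move=> h0 hr; have i0 := initial_force_gt0.
have gb i : i%:R * h <= S -> `|scheme h i - u0| <=
      2 * initial_force / (2 * k) * (expR (2 * k * (i%:R * h)) - 1) ->
    `|g (i%:R * h) (scheme h i)| <= force_bound.
  move=> iS iu; have ih : 0 <= i%:R * h by rewrite mulr_ge0// ltW.
  have := @force_le (i%:R * h) (scheme h i); rewrite ih iS => /(_ isT) gi.
  have := ler_wpM2l (ltW k0) iu.
  have -> : k * (2 * initial_force / (2 * k) * (expR (2 * k * (i%:R * h)) - 1)) =
    initial_force * expR (2 * k * (i%:R * h)) - initial_force.
    by field; rewrite gt_eqF.
  have : initial_force * expR (2 * k * (i%:R * h)) <= force_bound.
    by rewrite ler_wpM2l ?(ltW i0)// ler_expR ler_wpM2l// mulr_ge0// ltW.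
  by lra.
elim: j => [|j IH] jS.
  have u00 : `|scheme h 0 - u0| <= 2 * initial_force / (2 * k) * (expR (2 * k * (0%:R * h)) - 1).
    by rewrite /= subrr normr0 mul0r mulr0 expR0 subrr mulr0.
  by split => //; exact: gb.
have jS' : j%:R * h <= S by move: jS; rewrite time_succ; lra.
have [Cj uj gj] := IH jS'.
have ghr : h * `|g (j%:R * h) (scheme h j)| < r.
  by apply: le_lt_trans hr; rewrite ler_wpM2l// ltW.
have [Cz near _] := catch_upP hdot r0 (g_reg (j%:R * h)) Cj h0 ghr.
have uj1 : `|scheme h j.+1 - u0| <=
    2 * initial_force / (2 * k) * (expR (2 * k * (j.+1%:R * h)) - 1).
  rewrite (time_succ h j).
  apply: (gronwall_step _ _ (ltW h0) uj); rewrite ?mulr_gt0 ?mulr_ge0 ?(ltW i0)//.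
  have ih : 0 <= j%:R * h by rewrite mulr_ge0// ltW.
  have := @force_le (j%:R * h) (scheme h j); rewrite ih jS' => /(_ isT) gl.
  have := near _ Cj; rewrite (addrAC _ _ (- scheme h j)) subrr add0r normrZ (gtr0_norm h0) => nr.
  have := ler_wpM2l (ltW h0) gl.
  move: nr; set x := scheme h j; set z := catch_up _ _ _ _ => nr.
  have := ler_normB (h *: g (j%:R * h) x) (x + h *: g (j%:R * h) x - z).
  have -> : h *: g (j%:R * h) x - (x + h *: g (j%:R * h) x - z) = z - x.
    by apply: (dot_inj hdot) => w; rewrite !dotE; ring.
  have := ler_normD (z - x) (x - u0); rewrite subrKA normrZ (gtr0_norm h0).
  by rewrite /=; lra.
by split => //; apply: gb.
Qed.

Lemma scheme_catching_up h N : 0 < h -> h * force_bound < r -> N%:R * h <= S ->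
  catching_up dot C g S (2 * force_bound) force_bound (force_bound / (2 * r))
    h N (scheme h).
Proof.
move=> h0 hr NS.
have jS j : (j <= N)%N -> j%:R * h <= S.
  by move=> jN; apply: le_trans NS; rewrite ler_wpM2r ?ler_nat// ltW.
have spec j : (j < N)%N ->
  let n := h *: g (j%:R * h) (scheme h j) - (scheme h j.+1 - scheme h j) in
  `|n| <= h * `|g (j%:R * h) (scheme h j)| /\
  forall c, C c -> dot n (c - scheme h j.+1) <=
    h * (force_bound / (2 * r)) * `|c - scheme h j.+1| ^+ 2.
  move=> jN; have [Cj uj gj] := scheme_bounds h0 hr (jS _ (ltnW jN)).
  have ghr : h * `|g (j%:R * h) (scheme h j)| < r.
    by apply: le_lt_trans hr; rewrite ler_wpM2l// ltW.
  have [Cz near pr] := catch_upP hdot r0 (g_reg (j%:R * h)) Cj h0 ghr.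
  have -> : h *: g (j%:R * h) (scheme h j) - (scheme h j.+1 - scheme h j) =
      scheme h j + h *: g (j%:R * h) (scheme h j) - scheme h j.+1.
    by apply: (dot_inj hdot) => w; rewrite !dotE; ring.
  split.
    rewrite (le_trans (near _ Cj))// (addrAC _ _ (- scheme h j)) subrr add0r normrZ.
    by rewrite gtr0_norm.
  move=> c Cc; apply: (le_trans (pr _ Cc)).
  rewrite ler_wpM2r ?sqr_ge0// ler_wpM2l ?(ltW h0)// ler_wpM2r//.
  by rewrite invr_ge0 mulr_ge0 ?(ltW r0).
split => //.
- by move=> j /jS /(scheme_bounds h0 hr)[].
- move=> j jN; have [nl _] := spec j jN.
  have [_ _ gj] := scheme_bounds h0 hr (jS _ (ltnW jN)).
  have := ler_normB (h *: g (j%:R * h) (scheme h j))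
    (h *: g (j%:R * h) (scheme h j) - (scheme h j.+1 - scheme h j)).
  rewrite opprB addrC subrK normrZ (gtr0_norm h0).
  by have := ler_wpM2l (ltW h0) gj; move: nl; lra.
- move=> j jN; have [nl _] := spec j jN.
  have [_ _ gj] := scheme_bounds h0 hr (jS _ (ltnW jN)).
  by have := ler_wpM2l (ltW h0) gj; move: nl; lra.
- by move=> j c jN Cc; have [_ ] := spec j jN; apply.
Qed.

End catching_up_exists.

(** * Passage to the limit *)

(** The estimates [scheme_evi], [scheme_energy] and [scheme_shift] compare two
   times at a finite distance, so that they pass to pointwise limits, whereas a
   differential inclusion does not. *)
Record sweeping_limit {R : realType} {H : normedModType R}
    (dot : {dot H for idfun}) (C : set H) (g : R -> H -> H) (S L K b : R)
    (u0 : H) (v : R -> H) : Prop := SweepingLimit {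
  limit_init : v 0 = u0 ;
  limit_mem : forall t : R, 0 <= t <= S -> C (v t) ;
  limit_lip : forall s t : R, 0 <= s -> s <= t -> t <= S -> `|v t - v s| <= L * (t - s) ;
  limit_evi : forall (s t : R) c, 0 <= s -> s <= t -> t <= S -> C c ->
    dot ((t - s) *: g s (v s) - (v t - v s)) (c - v s) <=
    (t - s) * K * `|c - v s| ^+ 2 + b * (1 + `|c - v s|) * (t - s) ^+ 2 ;
  limit_energy : forall s t lam : R, 0 <= s -> s <= t -> t <= S -> 0 <= lam ->
    2 * lam * `|v t - v s| <=
    lam ^+ 2 * (t - s) + dot (g s (v s)) (v t - v s) + b * (t - s) ^+ 2 ;
  limit_shift : forall s t l : R, 0 <= s -> s <= t -> 0 <= l -> t + l <= S ->
    `|v (t + l) - v t| <= `|v (s + l) - v s| + b * l * (t - s) }.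

(** Limits of algebraic expressions, directed by the shape of the limit. *)
Local Ltac lims := lazymatch goal with
  | |- cvg_to (nbhs (fmap (fun _ => ?c) _)) _ => exact: cvg_cst
  | h : ?G |- ?G => exact: h
  | |- cvg_to _ (nbhs (_ - _)) => apply: cvgB; lims
  | |- cvg_to _ (nbhs (_ + _)) => apply: cvgD; lims
  | |- cvg_to _ (nbhs (_ * _)) => apply: cvgM; lims
  | |- cvg_to _ (nbhs (_ ^+ 2)) => apply: cvgM; lims
  | |- cvg_to _ (nbhs (_ *: _)) => apply: cvgZ; lims
  | |- cvg_to _ (nbhs `|_|) => apply: cvg_norm; lims
  | |- _ => eassumption
  end.

Section limit.
Context {R : realType} {H : completeNormedModType R}.
Variables (dot : {dot H for idfun}) (hdot : induces_norm dot).
Variables (C : set H) (g : R -> H -> H) (r k S : R) (u0 : H).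
Hypotheses (r0 : 0 < r) (k0 : 0 < k) (S0 : 0 < S) (Cu0 : C u0) (Ccl : closed C).
Hypothesis g_reg : forall t, dir_prox_regular r (g t) C.
Hypothesis g_lip : forall s t x y, `|g t x - g s y| <= k * (`|x - y| + `|t - s|).

Let M := force_bound g k S u0.
Let L := 2 * M.
Let K := M / (2 * r).
Let b := err k S L M K.

Let M0 : 0 < M. Proof. exact: force_bound_gt0. Qed.
Let L0 : 0 <= L. Proof. by rewrite mulr_ge0 ?ltW. Qed.
Let K0 : 0 <= K. Proof. by rewrite divr_ge0 ?(ltW M0)// mulr_ge0 ?(ltW r0). Qed.
Let b0 : 0 <= b. Proof. by apply: err_ge0 => //; exact: ltW. Qed.

(** Halving makes each mesh a refinement of all previous ones; the first step is
   such that no step leaves the reach of the prox-regularity. *)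
Let h_ n : R := r / (2 * M) * 2^-1 ^+ n.

Let h_gt0 n : 0 < h_ n.
Proof. by rewrite /h_ mulr_gt0 ?exprn_gt0 ?invr_gt0// divr_gt0// mulr_gt0. Qed.

Let h_lt n : h_ n * M < r.
Proof.
have -> : h_ n * M = r * (2^-1 * 2^-1 ^+ n).
  by rewrite /h_; field; rewrite gt_eqF.
rewrite gtr_pMr// (le_lt_trans (_ : _ <= 2^-1)) ?invf_lt1 ?ltr1n//.
by rewrite ler_piMr ?invr_ge0 ?exprn_ile1 ?invr_ge0 ?invf_le1 ?ler1n.
Qed.

Let h_cvg : h_ n @[n --> \oo] --> 0.
Proof. by apply: cvg_geometric; rewrite ger0_norm ?invr_ge0// invf_lt1 ?ltr1n. Qed.

Let h_split n p : h_ n = (2 ^ p)%N%:R * h_ (n + p)%N.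
Proof.
have e : (2 : R) ^+ p * 2^-1 ^+ p = 1 by rewrite -exprMn divff ?expr1n.
rewrite /h_ exprD natrX.
move: e; move: (2 ^+ p) (2^-1 ^+ p) (2^-1 ^+ n) (r / (2 * M)) => A B X c e.
transitivity (c * X * (A * B)); first by rewrite e mulr1.
by ring.
Qed.

Let u_ n : nat -> H := scheme C g u0 (h_ n).

Let u_ok n N : N%:R * h_ n <= S -> catching_up dot C g S L M K (h_ n) N (u_ n).
Proof. by move=> NS; apply: scheme_catching_up. Qed.

Let idx n (t : R) : nat := Num.truncn (t / h_ n).

Let idxP n (t : R) : 0 <= t -> (idx n t)%:R * h_ n <= t < (idx n t)%:R * h_ n + h_ n.
Proof.
move=> t0; have /truncn_itv : 0 <= t / h_ n by rewrite divr_ge0// ltW.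
by rewrite -/(idx n t) ler_pdivlMr// ltr_pdivrMr// time_succ.
Qed.

Let idx_cvg (t : R) : 0 <= t -> (idx n t)%:R * h_ n @[n --> \oo] --> t.
Proof.
move=> t0; have th : t - h_ n @[n --> \oo] --> t.
  by rewrite -[X in _ --> X]subr0; apply: cvgB => //; exact: cvg_cst.
apply: (squeeze_cvgr _ th (cvg_cst t)).
by near=> n; have := idxP n t0; lra.
Unshelve. all: by end_near. Qed.

Let mesh_errS := mesh_err k S L M K.

(** The comparison on the coarse mesh, plus the motion on the fine mesh since the
   last coarse time. *)
Let u_close n p (t : R) : 0 <= t <= S ->
  `|u_ n (idx n t) - u_ (n + p)%N (idx (n + p) t)| <=
  Num.sqrt (mesh_errS * h_ n) + L * h_ n.
Proof.
move=> /andP[t0 tS].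
have := idxP n t0; have := idxP (n + p) t0.
set j := idx n t; set i := idx (n + p) t; set h := h_ (n + p)%N.
have h0 : 0 < h := h_gt0 _.
set q := (2 ^ p)%N; have q0 : (0 < q)%N by rewrite expn_gt0.
have hq : h_ n = q%:R * h := h_split n p.
move=> /andP[ih ih1] /andP[jh jh1].
have jqh : (j * q)%N%:R * h = j%:R * h_ n by rewrite natrM hq mulrA.
have ji : (j * q <= i)%N.
  rewrite -ltnS -(ltr_nat R) -(ltr_pM2r h0) jqh time_succ.
  exact: le_lt_trans ih1.
have Xh : catching_up dot C g S L M K (q%:R * h) j (u_ n).
  by rewrite -hq; apply: u_ok; exact: le_trans tS.
have Yh : catching_up dot C g S L M K h i (u_ (n + p)%N).
  by apply: u_ok; exact: le_trans tS.
have Yjq : catching_up dot C g S L M K h (j * q)%N (u_ (n + p)%N).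
  by apply: u_ok; rewrite -/h jqh; exact: le_trans tS.
have := scheme_compare hdot k0 S0 L0 (ltW M0) K0 g_lip q0 Xh Yjq erefl (leqnn j).
rewrite -hq -/mesh_errS => /ler_wsqrtr; rewrite sqrtr_sqr normr_id => c1.
have jii : (j * q + (i - j * q) <= i)%N by rewrite subnKC.
have := scheme_lip Yh jii; rewrite subnKC// => c2.
have c3 : (i - j * q)%N%:R * h <= h_ n by rewrite natrB// mulrBl jqh; lra.
have := ler_wpM2l L0 c3.
have := ler_normB (u_ n j - u_ (n + p)%N (j * q)%N)
  (u_ (n + p)%N i - u_ (n + p)%N (j * q)%N).
have -> : forall x y z : H, (x - y) - (z - y) = x - z.
  by move=> x y z; rewrite opprB addrA subrK.
by move: c1 c2; lra.
Qed.

Let v t : H := lim (u_ n (idx n t) @[n --> \oo]).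

Let v_cvg (t : R) : 0 <= t <= S -> u_ n (idx n t) @[n --> \oo] --> v t.
Proof.
move=> tS; apply/cauchy_cvgP/cauchy_exP => e e0.
have sq : Num.sqrt (mesh_errS * h_ n) @[n --> \oo] --> Num.sqrt (mesh_errS * 0).
  have mh : mesh_errS * h_ n @[n --> \oo] --> mesh_errS * 0.
    exact: cvgM (cvg_cst _) h_cvg.
  exact: (continuous_cvg _ (@sqrt_continuous R _) mh).
have : Num.sqrt (mesh_errS * h_ n) + L * h_ n @[n --> \oo] -->
    Num.sqrt (mesh_errS * 0) + L * 0.
  by apply: cvgD => //; exact: cvgM (cvg_cst _) h_cvg.
rewrite !mulr0 sqrtr0 addr0.
move=> to0; have [n _ /(_ n (leqnn n)) /= ne] := cvgr0_norm_lt _ to0 e e0.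
exists (u_ n (idx n t)); exists n => // m /= nm.
rewrite -ball_normE /=; apply: le_lt_trans ne.
by rewrite -(subnKC nm) (le_trans (u_close _ _ tS))// ler_norm.
Unshelve. all: by []. Qed.

(** The scheme is Lipschitz in time uniformly in the mesh, so that only the limit of
   the mesh times matters. *)
Let sample (t : R) (i : nat -> nat) : 0 <= t <= S -> (forall n, (i n)%:R * h_ n <= S) ->
  (i n)%:R * h_ n @[n --> \oo] --> t -> u_ n (i n) @[n --> \oo] --> v t.
Proof.
move=> tS iS it; have t0 : 0 <= t by case/andP: tS.
have d0 : (L * `|(i n)%:R * h_ n - (idx n t)%:R * h_ n|) @[n --> \oo] --> 0.
  rewrite -(mulr0 L); apply: cvgMr; apply/norm_cvg0P.
  by rewrite -(subrr t); apply: cvgB => //; exact: idx_cvg.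
have : (u_ n (i n) - u_ n (idx n t)) @[n --> \oo] --> 0.
  apply/norm_cvg0P; apply: squeeze_cvgr d0; last exact: cvg_cst.
  near=> n; rewrite normr_ge0/=.
  have tn : (idx n t)%:R * h_ n <= S.
    by case/andP: tS (idxP n t0) => _ tS' /andP[+ _] => /le_trans; apply.
  have [ji|/ltnW ij] := leqP (i n) (idx n t).
    have jj : (i n + (idx n t - i n) <= idx n t)%N by rewrite subnKC.
    have := scheme_lip (u_ok tn) jj; rewrite subnKC// distrC => /le_trans; apply.
    rewrite ler_wpM2l// natrB// mulrBl distrC; exact: ler_norm.
  have jj : (idx n t + (i n - idx n t) <= i n)%N by rewrite subnKC.
  have := scheme_lip (u_ok (iS n)) jj; rewrite subnKC// => /le_trans; apply.
  rewrite ler_wpM2l// natrB// mulrBl; exact: ler_norm.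
move=> ud; have : (u_ n (i n) - u_ n (idx n t)) + u_ n (idx n t) @[n --> \oo] -->
    0 + v t by apply: cvgD => //; exact: v_cvg.
by rewrite add0r; under eq_fun do rewrite subrK.
Unshelve. all: by end_near. Qed.

Let gap_cvg (s t : R) (i := idx ^~ s) (m := idx ^~ (t - s)) : 0 <= s -> s <= t -> t <= S ->
  [/\ forall n, (i n + m n)%N%:R * h_ n <= S,
    (i n)%:R * h_ n @[n --> \oo] --> s,
    (m n)%:R * h_ n @[n --> \oo] --> t - s,
    u_ n (i n) @[n --> \oo] --> v s &
    u_ n (i n + m n)%N @[n --> \oo] --> v t /\
    g ((i n)%:R * h_ n) (u_ n (i n)) @[n --> \oo] --> g s (v s)].
Proof.
move=> s0 st tS; have ts : 0 <= t - s by rewrite subr_ge0.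
have imS n : (i n + m n)%N%:R * h_ n <= S.
  by rewrite natrD mulrDl; have := idxP n s0; have := idxP n ts; rewrite /i /m; lra.
have is_ : (i n)%:R * h_ n @[n --> \oo] --> s by exact: idx_cvg.
have ms : (m n)%:R * h_ n @[n --> \oo] --> t - s by exact: idx_cvg.
have us : u_ n (i n) @[n --> \oo] --> v s by apply: v_cvg; rewrite s0 (le_trans st).
split => //; split.
  apply: sample => //; first by rewrite (le_trans s0).
  rewrite -[X in _ --> X](subrKC s).
  by under eq_fun do rewrite natrD mulrDl; apply: cvgD.
apply/subr_cvg0/norm_cvg0P.
have : (k * (`|u_ n (i n) - v s| + `|(i n)%:R * h_ n - s|) : R^o) @[n --> \oo] --> 0.
  rewrite -[X in _ --> X](mulr0 k) -[X in _ --> k * X](addr0 0).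
  by apply: cvgMr; apply: cvgD; apply/norm_cvg0P/subr_cvg0.
apply: squeeze_cvgr; last exact: cvg_cst.
by near=> n; rewrite normr_ge0/=.
Unshelve. all: by end_near. Qed.

Lemma sweeping_limit_exists : exists L K b v,
  [/\ 0 <= L, 0 <= K, 0 <= b & sweeping_limit dot C g S L K b u0 v].
Proof.
exists L, K, b, v; split => //.
have mem (t : R) : 0 <= t <= S -> C (v t).
  move=> tS; apply: (@closed_cvg _ _ _ _ (fun n => u_ n (idx n t)) C Ccl _ _ (v_cvg tS)).
  near=> n; apply: (step_mem (u_ok _) (leqnn _)).
  by case/andP: tS => t0; apply: le_trans; case/andP: (idxP n t0).
split => //.
- rewrite /v (_ : (fun n => _) = fun=> u0) ?lim_cst//.
  by apply/funext => n; rewrite /idx mul0r truncn0.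
- move=> s t s0 st tS; have [imS is_ ms us [ut _]] := gap_cvg s0 st tS.
  have lhs : `|u_ n (idx n s + idx n (t - s)) - u_ n (idx n s)| @[n --> \oo] -->
    `|v t - v s| by lims.
  have rhs : L * ((idx n (t - s))%:R * h_ n) @[n --> \oo] --> L * (t - s) by lims.
  apply: (ler_cvg_to lhs rhs).
  by apply: nearW => n; exact: (scheme_lip (u_ok (imS n))).
- move=> s t c s0 st tS Cc; have [imS is_ ms us [ut gs]] := gap_cvg s0 st tS.
  have cu : c - u_ n (idx n s) @[n --> \oo] --> c - v s by lims.
  set y := fun n => u_ n (idx n s + idx n (t - s))%N in ut *.
  pose m n := (idx n (t - s))%:R * h_ n.
  have ms' : m n @[n --> \oo] --> t - s := ms.
  have lhs : dot (m n *: g ((idx n s)%:R * h_ n) (u_ n (idx n s)) -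
      (y n - u_ n (idx n s))) (c - u_ n (idx n s)) @[n --> \oo] -->
      dot ((t - s) *: g s (v s) - (v t - v s)) (c - v s).
    by apply: (cvg_dot hdot); lims.
  have rhs : m n * K * `|c - u_ n (idx n s)| ^+ 2 +
      b * (1 + `|c - u_ n (idx n s)|) * m n ^+ 2 @[n --> \oo] -->
      (t - s) * K * `|c - v s| ^+ 2 + b * (1 + `|c - v s|) * (t - s) ^+ 2.
    by lims.
  apply: (ler_cvg_to lhs rhs).
  by apply: nearW => n; exact: (scheme_evi hdot k0 S0 L0 (ltW M0) K0 g_lip
    (u_ok (imS n)) (leqnn _) Cc).
- move=> s t lam s0 st tS lam0; have [imS is_ ms us [ut gs]] := gap_cvg s0 st tS.
  set y := fun n => u_ n (idx n s + idx n (t - s))%N in ut *.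
  pose m n := (idx n (t - s))%:R * h_ n.
  have ms' : m n @[n --> \oo] --> t - s := ms.
  have lhs : 2 * lam * `|y n - u_ n (idx n s)| @[n --> \oo] -->
      2 * lam * `|v t - v s| by lims.
  have en : dot (g ((idx n s)%:R * h_ n) (u_ n (idx n s))) (y n - u_ n (idx n s))
      @[n --> \oo] --> dot (g s (v s)) (v t - v s).
    by apply: (cvg_dot hdot); lims.
  have rhs : lam ^+ 2 * m n + dot (g ((idx n s)%:R * h_ n) (u_ n (idx n s)))
      (y n - u_ n (idx n s)) + b * m n ^+ 2 @[n --> \oo] -->
      lam ^+ 2 * (t - s) + dot (g s (v s)) (v t - v s) + b * (t - s) ^+ 2.
    by lims.
  apply: (ler_cvg_to lhs rhs).
  by apply: nearW => n; exact: (scheme_energy hdot k0 S0 L0 (ltW M0) K0 g_lip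
    (u_ok (imS n)) (leqnn _) lam0).
- move=> s t l s0 st l0 tlS.
  have tS : t <= S by lra.
  have [imS is_ ms us [ut _]] := gap_cvg s0 st tS.
  have ls : (idx n l)%:R * h_ n @[n --> \oo] --> l by exact: idx_cvg.
  have ts : 0 <= t - s by lra.
  have pmS n : (idx n s + idx n (t - s) + idx n l)%N%:R * h_ n <= S.
    rewrite !natrD !mulrDl.
    by have := idxP n s0; have := idxP n ts; have := idxP n l0; lra.
  have smS n : (idx n s + idx n l)%N%:R * h_ n <= S.
    rewrite !natrD !mulrDl.
    by have := idxP n s0; have := idxP n l0; lra.
  have usl : u_ n (idx n s + idx n l)%N @[n --> \oo] --> v (s + l).
    apply: sample => //; first by lra.
    by under eq_fun do rewrite natrD mulrDl; apply: cvgD.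
  have utl : u_ n (idx n s + idx n (t - s) + idx n l)%N @[n --> \oo] --> v (t + l).
    apply: sample => //; first by lra.
    rewrite -[X in _ --> X + l](subrKC s).
    by under eq_fun do rewrite !natrD !mulrDl; apply: cvgD => //; apply: cvgD.
  have lhs : `|u_ n (idx n s + idx n (t - s) + idx n l)%N -
      u_ n (idx n s + idx n (t - s))%N| @[n --> \oo] --> `|v (t + l) - v t|.
    by lims.
  have rhs : `|u_ n (idx n s + idx n l)%N - u_ n (idx n s)| +
      b * ((idx n l)%:R * h_ n) * ((idx n (t - s))%:R * h_ n) @[n --> \oo] -->
      `|v (s + l) - v s| + b * l * (t - s) by lims.
  apply: (ler_cvg_to lhs rhs); apply: nearW => n.
  exact: (scheme_shift hdot k0 S0 L0 (ltW M0) K0 g_lip (u_ok (pmS n)) (leqnn _)).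
Unshelve. all: by end_near. Qed.

End limit.

(** * Differentiability of the limit off a countable set *)

Section left_continuity.
Context {R : realType}.

(** Outside its jumps a monotone function is left-continuous: between the two
   one-sided limits, which then agree, there is no room for its value. *)
Lemma monotone_left_continuous (F : R -> R) (a b : R) :
  {in `[a, b] &, {homo F : x y / x <= y}} ->
  exists2 N : set R, countable N & (forall t e : R, a < t < b -> ~ N t -> 0 < e ->
    exists2 d : R, 0 < d & forall x : R, t - d < x < t -> F t - e < F x).
Proof.
move=> ndF; exists [set x | x \in (`]a, b[) /\ discontinuity F x].
  exact: discontinuity_countable.
move=> t e /andP[at_ tb] Nt e0.
have ab : t \in `[a, b] by rewrite in_itv/= !ltW.
have cl : cvg (F x @[x --> t^'-]).
  apply: nondecreasing_at_left_is_cvgr.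
    near=> x => y z; rewrite !in_itv/= => /andP[xy yt] /andP[xz zt].
    have ax : a < x by near: x; exact: nbhs_left_gt.
    by apply: ndF; rewrite in_itv/=; apply/andP; split; lra.
  near=> x; exists (F t) => _ [y /= + <-]; rewrite in_itv/= => /andP[xy yt].
  have ax : a < x by near: x; exact: nbhs_left_gt.
  by apply: ndF => //; last lra; rewrite in_itv/=; apply/andP; split; lra.
have cr : cvg (F x @[x --> t^'+]).
  apply: nondecreasing_at_right_is_cvgr.
    near=> x => y z; rewrite !in_itv/= => /andP[xy yt] /andP[xz zt].
    have ax : x < b by near: x; exact: nbhs_right_lt.
    by apply: ndF; rewrite in_itv/=; apply/andP; split; lra.
  near=> x; exists (F t) => _ [y /= + <-]; rewrite in_itv/= => /andP[xy yt].
  have ax : x < b by near: x; exact: nbhs_right_lt.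
  by apply: ndF => //; last lra; rewrite in_itv/=; apply/andP; split; lra.
have FrFl : lim (F x @[x --> t^'-]) = lim (F x @[x --> t^'+]).
  apply/eqP; apply: contra_notT Nt => ne; split; first by rewrite in_itv/= at_ tb.
  by split.
have : F t <= lim (F x @[x --> t^'+]).
  apply: limr_ge => //; near=> x.
  have xb : x < b by near: x; exact: nbhs_right_lt.
  have tx : t < x by near: x; exact: nbhs_right_gt.
  have xab : x \in `[a, b] by rewrite in_itv/=; apply/andP; split; lra.
  by apply: ndF => //; exact: ltW.
rewrite -FrFl => Fl.
have [|d /= d0 dP] := cvgr_gt _ cl (F t - e); first by lra.
exists d => // x /andP[dx xt]; apply: dP => //=.
by rewrite ger0_norm; lra.
Unshelve. all: by end_near. Qed.

End left_continuity.

Section quotient_comparison.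
Context {R : realType} {H : normedModType R}.
Implicit Types (a w q p : H) (L beta h k l e eta sp : R).

(** The estimate that identifies left and right derivatives: [a] is a left
   quotient over a step [h], [q] a right quotient over [k], [w] the quotient
   over both steps, [p] the right derivative and [sp] the right speed just
   before; [l] stands for the ratio of [h] to [h + k]. As [a] is hardly longer than [p] while [w] is close to [p], the
   comparison of the quotients [a] and [w] forces [a] towards [p]. *)
Lemma left_quotient_close a w q p L beta h k l e eta sp :
  0 <= L -> 0 <= beta -> 0 < e -> 0 < eta -> eta <= 1 -> eta <= e / 4 ->
  eta * (6 * L + 1 + 8 * beta) <= (e / 2) ^+ 2 ->
  h <= eta -> k <= eta -> l <= eta ->
  `|p| <= L -> `|q - p| <= eta -> `|w - q| <= eta ->
  0 <= sp -> sp <= `|p| + eta -> `|a| ^+ 2 <= sp ^+ 2 + 2 * beta * h ->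
  `|a - w| ^+ 2 <= `|a| ^+ 2 - `|w| ^+ 2 + 2 * beta * (h + k + l) ->
  `|a - p| <= e.
Proof.
move=> L0 bt e0 eta0 eta1 etae etac heta ke hkk pL kp wq sp0 rp ar aw.
have wp : `|w - p| <= 2 * eta.
  by have := ler_normD (w - q) (q - p); rewrite subrKA; lra.
have pw : `|p| <= `|w| + 2 * eta.
  by have := ler_normD (p - w) w; rewrite subrK distrC; lra.
have ap : `|a - p| <= `|a - w| + 2 * eta.
  by have := ler_normD (a - w) (w - p); rewrite subrKA; lra.
have p0 := normr_ge0 p; have w0 := normr_ge0 w.
have r2 : sp ^+ 2 <= (`|p| + eta) ^+ 2.
  by rewrite lerXn2r ?nnegrE// addr_ge0// ltW.
have w2 : `|p| ^+ 2 - 4 * eta * L <= `|w| ^+ 2.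
  have [pe|pe] := leP `|p| (2 * eta).
    have := ler_pM p0 p0 pe pL; have := sqr_ge0 `|w|.
    by have := mulr_ge0 (ltW eta0) L0; lra.
  have s1 : (`|p| - 2 * eta) ^+ 2 <= `|w| ^+ 2.
    by rewrite lerXn2r ?nnegrE ?subr_ge0 ?(ltW pe)// lerBlDr.
  have := ler_wpM2l (ltW eta0) pL; have := sqr_ge0 eta.
  by lra.
have aw2 : `|a - w| ^+ 2 <= (e / 2) ^+ 2.
  have b1 := ler_wpM2l bt hkk; have b2 := ler_wpM2l bt heta.
  have b3 := ler_wpM2l bt ke.
  have b4 := ler_wpM2l (ltW eta0) pL; have b5 := ler_wpM2l (ltW eta0) eta1.
  by lra.
have : `|a - w| <= e / 2.
  by move: aw2; rewrite ler_pXn2r// ?nnegrE// divr_ge0// ltW.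
by lra.
Qed.

End quotient_comparison.

Section derivative.
Context {R : realType} {H : completeNormedModType R}.
Variables (dot : {dot H for idfun}) (hdot : induces_norm dot).
Variables (C : set H) (g : R -> H -> H) (S L K b : R) (u0 : H) (v : R -> H).
Hypotheses (L0 : 0 <= L) (K0 : 0 <= K) (b0 : 0 <= b).
Hypothesis hv : sweeping_limit dot C g S L K b u0 v.

Let D (s l : R) : H := l^-1 *: (v (s + l) - v s).

Let beta : R := K * L ^+ 2 + b * (2 + L * S).

Let DK (s l : R) : 0 < l -> v (s + l) - v s = l *: D s l.
Proof. by move=> l0; rewrite scalerA divff ?scale1r// gt_eqF. Qed.

Let D_norm (s l : R) : 0 <= s -> 0 < l -> s + l <= S -> `|D s l| <= L.
Proof.
move=> s0 l0 lS; have sl : s <= s + l by lra.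
have := limit_lip hv s0 sl lS; rewrite DK// normrZ gtr0_norm//.
by rewrite [s + l]addrC addrK [leRHS]mulrC ler_pM2l.
Qed.

Let D_evi (s l : R) c : 0 <= s -> 0 < l -> s + l <= S -> C c ->
  dot (g s (v s) - D s l) (c - v s) <=
  K * `|c - v s| ^+ 2 + b * (1 + `|c - v s|) * l.
Proof.
move=> s0 l0 lS Cc; have sl : s <= s + l by lra.
have := limit_evi hv s0 sl lS Cc; rewrite DK// [s + l]addrC addrK.
rewrite -scalerBr dotZl => ev; rewrite -(ler_pM2l l0) (le_trans ev)//.
by rewrite le_eqVlt; apply/orP; left; apply/eqP; ring.
Qed.

Let D_energy (s l : R) : 0 <= s -> 0 < l -> s + l <= S ->
  `|D s l| ^+ 2 <= dot (g s (v s)) (D s l) + b * l.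
Proof.
move=> s0 l0 lS; have sl : s <= s + l by lra.
have := limit_energy hv s0 sl lS (normr_ge0 (D s l)).
rewrite DK// (normrZ l) (gtr0_norm l0) dotZr [s + l]addrC addrK => en.
have : l * `|D s l| ^+ 2 <= l * (dot (g s (v s)) (D s l) + b * l) by lra.
by rewrite ler_pM2l.
Qed.

Let D_shift (s t l : R) : 0 <= s -> s <= t -> 0 < l -> t + l <= S ->
  `|D t l| <= `|D s l| + b * (t - s).
Proof.
move=> s0 st l0 lS; have := limit_shift hv s0 st (ltW l0) lS.
rewrite !DK// !(normrZ l) (gtr0_norm l0) => sh.
have : l * `|D t l| <= l * (`|D s l| + b * (t - s)) by lra.
by rewrite ler_pM2l.
Qed.

Let S_beta (s l : R) : 0 <= s -> 0 < l -> s + l <= S -> 0 <= beta.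
Proof.
move=> s0 l0 lS; have S0 : 0 <= S by lra.
by rewrite /beta addr_ge0// mulr_ge0 ?sqr_ge0// addr_ge0// mulr_ge0.
Qed.

(** For [h] much smaller than [l], the variational inequality over [h] tested with
   [v (s + l)] says that the force works at most as much as [D s h] along
   [D s l], and the energy estimate that it works at least [`|D s l| ^+ 2].
   So, up to small errors, [D s h - D s l] makes no obtuse angle with [D s l]. *)
Let D_cmp (s h l : R) : 0 <= s -> 0 < h -> s + h <= S -> 0 < l -> s + l <= S ->
  `|D s h - D s l| ^+ 2 <=
  `|D s h| ^+ 2 - `|D s l| ^+ 2 + 2 * beta * (l + h / l).
Proof.
move=> s0 h0 hS l0 lS.
have Csl : C (v (s + l)) by apply: (limit_mem hv); rewrite lS addr_ge0// ltW.
have := D_evi s0 h0 hS Csl; rewrite DK// (normrZ l) (gtr0_norm l0) dotZr dotBl.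
have en := D_energy s0 l0 lS; have nl := D_norm s0 l0 lS.
rewrite (sqr_normB hdot).
move: (normr_ge0 (D s l)) nl en; set w := `|D s l|; set d1 := dot _ (D s l).
set d2 := dot _ (D s l) => w0 nl en ev.
have lS' : l <= S by lra.
have e1 : l * (d1 - d2) <= l * (K * L ^+ 2 * l + b * (1 + L * S) * (h / l)).
  apply: (le_trans ev).
  have -> : l * (K * L ^+ 2 * l + b * (1 + L * S) * (h / l)) =
    K * (l ^+ 2 * L ^+ 2) + b * (1 + L * S) * h by field; rewrite gt_eqF.
  have x1 : (l * w) ^+ 2 <= l ^+ 2 * L ^+ 2.
    by rewrite exprMn ler_wpM2l ?sqr_ge0// lerXn2r ?nnegrE.
  have x2 : l * w <= L * S by rewrite mulrC ler_pM ?(ltW l0).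
  have y1 := ler_wpM2l K0 x1.
  have y2 := ler_wpM2l (mulr_ge0 b0 (ltW h0)) x2.
  by lra.
rewrite ler_pM2l// in e1.
have hl : 0 <= h / l by rewrite divr_ge0 ?(ltW l0) ?(ltW h0).
have S0 : 0 <= S by lra.
have p1 := mulr_ge0 (mulr_ge0 b0 (mulr_ge0 L0 S0)) (ltW l0).
have p2 := mulr_ge0 b0 (ltW l0); have p3 := mulr_ge0 b0 hl.
have p4 := mulr_ge0 (mulr_ge0 K0 (sqr_ge0 L)) hl.
by rewrite /beta; lra.
Qed.

Let near_small (s e : R) : 0 < e -> s < S ->
  \forall h \near 0^'+, [/\ 0 < h, s + h <= S & h <= e].
Proof.
move=> e0 sS; near=> h.
have h0 : 0 < h by near: h; exact: nbhs_right_gt.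
have he : h < e by near: h; exact: nbhs_right_lt.
have hS : h < S - s by near: h; apply: nbhs_right_lt; lra.
by split; lra.
Unshelve. all: by end_near. Qed.

(** By [D_cmp] the squared lengths of the quotients increase, up to small errors, as
   the step decreases, and a quotient of almost maximal length is close to all
   quotients over much smaller steps. *)
Lemma right_derivative (s : R) : 0 <= s -> s < S -> cvg (D s h @[h --> 0^'+]).
Proof.
move=> s0 sS; apply/cauchy_cvgP/cauchy_exP => e e0.
pose E := [set `|D s l| ^+ 2 - 2 * beta * l | l in [set l | 0 < l /\ s + l <= S]].
have bt : 0 <= beta by apply: (@S_beta s (S - s)); lra.
have supE : has_sup E.
  split; first by exists (`|D s (S - s)| ^+ 2 - 2 * beta * (S - s)), (S - s) => //; split; lra.
  exists (L ^+ 2) => _ [l [l0 lS] <-].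
  have := D_norm s0 l0 lS => Dl.
  have : `|D s l| ^+ 2 <= L ^+ 2 by rewrite lerXn2r ?nnegrE.
  by have := mulr_ge0 bt (ltW l0); lra.
(* Almost maximal for the length corrected by the error of [D_cmp] in [l]. *)
have e4 : 0 < (e / 2) ^+ 2 by rewrite exprn_gt0// divr_gt0.
have [_ [l [l0 lS] <-] lm] := sup_adherent e4 supE.
exists (D s l); have d0 : 0 < (e / 2) ^+ 2 / (2 * beta * (1 + l^-1) + 1).
  rewrite divr_gt0// ltr_wpDl// mulr_ge0 ?mulr_ge0//.
  by rewrite addr_ge0// invr_ge0 ltW.
have := near_small d0 sS; apply: filterS => h [h0 hS].
rewrite ler_pdivlMr; last first.
  rewrite ltr_wpDl// mulr_ge0 ?mulr_ge0// addr_ge0// invr_ge0 ltW//.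
move=> hd; rewrite -ball_normE /= distrC.
have : E (`|D s h| ^+ 2 - 2 * beta * h) by exists h.
move=> /(sup_upper_bound supE) hm.
have := D_cmp s0 h0 hS l0 lS => cmp.
have : `|D s h - D s l| ^+ 2 < e ^+ 2.
  move: e4; rewrite exprMn exprVn => e4.
  have := sqr_ge0 e; rewrite exprMn exprVn in lm hd.
  by lra.
by rewrite ltr_pXn2r ?nnegrE ?(ltW e0).
Qed.

Definition right_deriv (s : R) : H := lim (h^-1 *: (v (s + h) - v s) @[h --> 0^'+]).

Let D_cvg (s : R) : 0 <= s -> s < S -> D s h @[h --> 0^'+] --> right_deriv s.
Proof. exact: right_derivative. Qed.

Lemma right_deriv_evi (s : R) c : 0 <= s -> s < S -> C c ->
  dot (g s (v s) - right_deriv s) (c - v s) <= K * `|c - v s| ^+ 2.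
Proof.
move=> s0 sS Cc.
have lhs : dot (g s (v s) - D s h) (c - v s) @[h --> 0^'+] -->
    dot (g s (v s) - right_deriv s) (c - v s).
  apply: (cvg_dot hdot); last exact: cvg_cst.
  by apply: cvgB; [exact: cvg_cst | exact: D_cvg].
have rhs : K * `|c - v s| ^+ 2 + b * (1 + `|c - v s|) * h @[h --> 0^'+] -->
    K * `|c - v s| ^+ 2 + b * (1 + `|c - v s|) * 0.
  apply: cvgD; first exact: cvg_cst.
  by apply: cvgM; [exact: cvg_cst | exact: cvg_at_right_filter].
rewrite mulr0 addr0 in rhs; apply: (ler_cvg_to lhs rhs).
have := near_small ltr01 sS; apply: filterS => h [h0 hS _].
exact: D_evi.
Qed.

Let D_le_deriv (s l : R) : 0 <= s -> 0 < l -> s + l <= S ->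
  `|D s l| ^+ 2 <= `|right_deriv s| ^+ 2 + 2 * beta * l.
Proof.
move=> s0 l0 lS; have sS : s < S by lra.
have rhs : `|D s h| ^+ 2 + 2 * beta * (l + h / l) @[h --> 0^'+] -->
    `|right_deriv s| ^+ 2 + 2 * beta * (l + 0 / l).
  have dn : `|D s h| @[h --> 0^'+] --> `|right_deriv s| by apply: cvg_norm; exact: D_cvg.
  apply: cvgD; first exact: (cvgM dn dn).
  apply: cvgM; first exact: cvg_cst.
  apply: cvgD; first exact: cvg_cst.
  by apply: cvgM; [exact: cvg_at_right_filter | exact: cvg_cst].
rewrite mul0r addr0 in rhs; apply: (ler_cvg_to (cvg_cst _) rhs).
have := near_small ltr01 sS; apply: filterS => h [h0 hS _].
by have := D_cmp s0 h0 hS l0 lS; have := sqr_ge0 (`|D s h - D s l|); lra.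
Qed.

Lemma right_deriv_shift (s t : R) : 0 <= s -> s <= t -> t < S ->
  `|right_deriv t| <= `|right_deriv s| + b * (t - s).
Proof.
move=> s0 st tS; have t0 : 0 <= t by lra.
have sS : s < S by lra.
have lhs : `|D t h| @[h --> 0^'+] --> `|right_deriv t| by apply: cvg_norm; exact: D_cvg.
have rhs : `|D s h| + b * (t - s) @[h --> 0^'+] --> `|right_deriv s| + b * (t - s).
  by apply: cvgD; [apply: cvg_norm; exact: D_cvg | exact: cvg_cst].
apply: (ler_cvg_to lhs rhs).
have := near_small ltr01 tS; apply: filterS => h [h0 hS _].
exact: D_shift.
Qed.

Lemma right_deriv_norm (s : R) : 0 <= s -> s < S -> `|right_deriv s| <= L.
Proof.
move=> s0 sS.
have lhs : `|D s h| @[h --> 0^'+] --> `|right_deriv s| by apply: cvg_norm; exact: D_cvg.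
apply: (ler_cvg_to lhs (cvg_cst L)).
have := near_small ltr01 sS; apply: filterS => h [h0 hS _].
exact: D_norm.
Qed.

(** Applied at [t - h], [D_cmp] compares the quotient over [h] with the one over
   [h + k], which is close to the right quotient [D t k] when [h] is much smaller
   than [k]. *)
Let left_quotient (t e : R) : 0 < t -> t < S -> 0 < e ->
  (forall eta : R, 0 < eta -> exists2 d : R, 0 < d & forall x : R, t - d < x < t ->
     `|right_deriv x| <= `|right_deriv t| + eta) ->
  exists2 d : R, 0 < d & forall h : R, 0 < h -> h < d ->
    `|D (t - h) h - right_deriv t| <= e.
Proof.
move=> t0 tS e0 lc; have bt : 0 <= beta by apply: (@S_beta t (S - t)); lra.
set p := right_deriv t in lc *.
have pL : `|p| <= L by apply: right_deriv_norm; lra.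
pose c := 6 * L + 1 + 8 * beta.
have c0 : 0 < c by rewrite ltr_wpDr ?mulr_ge0 ?ltr_wpDl ?mulr_ge0.
have [eta [eta0 eta1 etae etac]] : exists eta : R,
    [/\ 0 < eta, eta <= 1, eta <= e / 4 & eta * c <= (e / 2) ^+ 2].
  exists (Num.min 1 (Num.min (e / 4) ((e / 2) ^+ 2 / c))); split.
  - by rewrite !lt_min ltr01 !divr_gt0 ?exprn_gt0 ?divr_gt0.
  - by rewrite ge_min lexx.
  - by rewrite !ge_min lexx orbT.
  - by rewrite -ler_pdivlMr// !ge_min lexx !orbT.
have [k [[k0 kS ke] kp]] : exists k : R, [/\ 0 < k, t + k <= S & k <= eta] /\
    `|D t k - p| <= eta.
  have : \forall h \near 0^'+, `|p - D t h| <= eta.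
    by apply: cvgr_dist_le eta0; apply: D_cvg; lra.
  move=> n2; have := @filter_ex _ _ _ _ (filterI (near_small eta0 tS) n2).
  by move=> [k [kk kp]]; exists k; rewrite distrC.
have [d d0 dP] := lc _ eta0.
have L1 : 0 < 2 * L + 1 by rewrite ltr_wpDl// mulr_ge0.
exists (Num.min d (Num.min t (Num.min (eta * k) (eta * k / (2 * L + 1))))).
  by rewrite !lt_min d0 t0 mulr_gt0// divr_gt0 ?mulr_gt0.
move=> h h0; rewrite !lt_min => /and4P[hd ht hk]; rewrite ltr_pdivlMr//.
move=> hL; have th0 : 0 <= t - h by lra.
have hth : t - h + h = t by lra.
have aS : t - h + h <= S by lra.
have hk0 : 0 < h + k by lra.
have cS : t - h + (h + k) <= S by lra.
have dh : `|right_deriv (t - h)| <= `|p| + eta.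
  by apply: dP; rewrite ltrD2l ltrN2 hd gtrBl.
have cE : D (t - h) (h + k) - D t k = (h / (h + k)) *: (D (t - h) h - D t k).
  have e1 : v (t + k) - v t = k *: D t k by exact: DK.
  have e2 : v t - v (t - h) = h *: D (t - h) h by rewrite -DK// hth.
  rewrite {1}/D (_ : t - h + (h + k) = t + k); last by lra.
  have -> : v (t + k) - v (t - h) = k *: D t k + h *: D (t - h) h.
    by rewrite -e1 -e2 subrKA.
  move: (D t k) (D (t - h) h) => q a; apply: (dot_inj hdot) => z.
  by rewrite !dotE; field; rewrite gt_eqF.
have wq : `|D (t - h) (h + k) - D t k| <= eta.
  rewrite cE normrZ ger0_norm; last by rewrite divr_ge0 ?(ltW h0) ?(ltW hk0).
  have x1 : `|D (t - h) h - D t k| <= 2 * L.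
    rewrite (le_trans (ler_normB _ _))// mulr_natl mulr2n lerD ?D_norm//.
    exact: ltW.
  rewrite mulrAC ler_pdivrMr//.
  have x2 := ler_wpM2l (ltW h0) x1; have x3 := mulr_ge0 (ltW eta0) (ltW h0).
  by lra.
have hkk : h / (h + k) <= eta.
  by rewrite ler_pdivrMr//; have := mulr_ge0 (ltW eta0) (ltW h0); lra.
have heta : h <= eta.
  by have := ler_wpM2l (ltW eta0) (le_trans ke eta1); lra.
apply: (left_quotient_close L0 bt e0 eta0 eta1 etae etac heta ke hkk pL kp wq
  (normr_ge0 (right_deriv (t - h))) dh).
- exact: D_le_deriv.
- exact: D_cmp.
Qed.

(** The speed decays along the motion up to a linear drift, so it jumps at most
   countably often; elsewhere the left quotients are in the limit not longer than
   the right derivative, and this forces them to converge to it. *)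
Lemma differentiable_off_countable (T : R) : T < S ->
  exists2 N : set R, countable N & forall t : R, 0 < t < T -> ~ N t ->
    h^-1 *: (v (h + t) - v t) @[h --> 0^'] --> right_deriv t.
Proof.
move=> TS; pose F s := b * s - `|right_deriv s|.
have ndF : {in `[0, T] &, {homo F : x y / x <= y}}.
  move=> x y; rewrite !in_itv/= => /andP[x0 xT] /andP[y0 yT] xy.
  by have yS : y < S by [lra]; have := right_deriv_shift x0 xy yS; rewrite /F; lra.
have [N cN lcN] := monotone_left_continuous ndF; exists N => // t tT Nt.
have /andP[t0 tT'] := tT; have tS : t < S by lra.
have lc (eta : R) : 0 < eta -> exists2 d : R, 0 < d & forall x : R, t - d < x < t ->
    `|right_deriv x| <= `|right_deriv t| + eta.
  move=> eta0; have [d d0 dP] := lcN t _ tT Nt eta0.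
  exists d => // x dx; have := dP x dx; rewrite /F => Fx.
  have /andP[_ xt] := dx.
  by have := ler_wpM2l b0 (ltW xt); lra.
apply/cvgrPdist_le => e e0.
have [d1 d10 d1P] := left_quotient t0 tS e0 lc.
have : \forall h \near 0^'+, `|right_deriv t - D t h| <= e.
  by apply: cvgr_dist_le e0; apply: D_cvg; lra.
move=> [d2 /= d20 d2P].
exists (Num.min d1 d2); first by rewrite /= lt_min d10 d20.
move=> h /=; rewrite sub0r normrN lt_min => /andP[h1 h2] hn0.
have [h0|h0|h0] := ltgtP h 0; last by rewrite h0 eqxx in hn0.
  have := d1P (- h); rewrite oppr_gt0 opprK => /(_ h0).
  rewrite ltr0_norm// in h1; move=> /(_ h1).
  rewrite distrC /D [t + h - h]addrK (addrC t) invrN scaleNr -scalerN opprB.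
  by [].
rewrite (addrC h); apply: d2P => //=.
by rewrite sub0r normrN.
Qed.

End derivative.

(** * Absolutely continuous functions with nonpositive derivative *)

Section absolutely_continuous.
Context {R : realType}.
Let mu := @lebesgue_measure R.

Lemma countable_negligible (N : set R) : countable N -> mu.-negligible N.
Proof.
move=> cN; exists N; split => //; last exact: countable_lebesgue_measure0.
by apply: countable_measurable => // t; exact: measurable_set1.
Qed.

Let null_cover (N : set R) (d : R) : mu.-negligible N -> 0 < d ->
  exists U, [/\ open U, N `<=` U & (mu U < d%:E)%E].
Proof.
move=> [A [mA A0 NA]] d0.
have [|U [oU AU Ud]] := @lebesgue_regularity_outer R A d mA _ d0.
  by rewrite [X in (X < _)%E](_ : _ = 0%E) ?ltry.
exists U; split => //; first exact: subset_trans AU.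
rewrite -(setDKU AU) (le_lt_trans (measureU2 _ _ _))//.
- by apply: measurableD => //; exact: open_measurable.
- by rewrite [X in (_ + X)%E](_ : _ = 0%E) ?adde0.
Qed.

Section chains.
Variables (F : R -> R) (U : set R) (e : R).
Hypotheses (oU : open U) (e0 : 0 <= e).

(** A chain leads from [0] to [t] by steps over which [F] has slope at most [e] and
   by steps inside [U]. The list keeps the latter only, the last one first; their
   total length is bounded by measure, and their increments are left to the
   absolute continuity of [F]. *)
Definition chain (t : R) (l : seq (R * R)) : Prop :=
  [/\ all (fun p => [&& 0 <= p.1, p.1 <= p.2 & p.2 <= t]) l,
    pairwise (fun p q => q.2 <= p.1) l,
    ((\sum_(p <- l) (p.2 - p.1))%R%:E <= mu (U `&` `]0%R, t[%classic))%E &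
    F t - F 0 <= e * t + \sum_(p <- l) `|F p.2 - F p.1|].

Lemma chain0 : chain 0 [::].
Proof. by split => //; rewrite big_nil// subrr mulr0 addr0. Qed.

Lemma chain_good (s t : R) l : chain s l -> s <= t -> F t - F s <= e * (t - s) ->
  chain t l.
Proof.
move=> [pl dl ml Fl] st Fst; split => //.
- apply: sub_all pl => p /and3P[-> -> /= /le_trans]; exact.
- apply: (le_trans ml); apply: le_measure.
  + by rewrite inE; apply: measurableI => //; exact: open_measurable.
  + by rewrite inE; apply: measurableI => //; exact: open_measurable.
  + by apply: setIS => x /=; rewrite !in_itv/= => /andP[-> /= /lt_le_trans]; exact.
- by lra.
Qed.

Lemma chain_bad (s t : R) l : chain s l -> 0 <= s -> s <= t -> `]s, t[ `<=` U ->
  chain t ((s, t) :: l).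
Proof.
move=> [pl dl ml Fl] s0 st sU; split => /=.
- rewrite s0 st lexx/=; apply: sub_all pl => p /and3P[-> -> /= /le_trans]; exact.
- rewrite dl andbT; apply: sub_all pl => p /and3P[_ _]; exact.
- rewrite big_cons/= EFinD addeC.
  have mst : mu `]s, t[ = (t - s)%:E.
    rewrite /mu lebesgue_measure_itv/= lte_fin -EFinB; case: ltP => // ts.
    by rewrite (_ : t - s = 0)//; apply/eqP; rewrite subr_eq0 eq_le ts.
  have mU : measurable U by exact: open_measurable.
  rewrite -mst; apply: (le_trans (leeD2r _ ml)).
  rewrite -measureU//.
  + apply: le_measure.
    * by rewrite inE; apply: measurableU => //; exact: measurableI.
    * by rewrite inE; exact: measurableI.
    * move=> x [[Ux]|] /=; rewrite !in_itv/= => /andP[x0 xs].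
        by split => //; rewrite x0 (lt_le_trans xs).
      split; last by rewrite xs (le_lt_trans s0).
      by apply: sU; rewrite /= in_itv/= x0.
  + exact: measurableI.
  + apply/seteqP; split => x //= -[[_]]; rewrite !in_itv/= => /andP[_ xs] /andP[sx].
    by have := lt_trans xs sx; rewrite ltxx.
- by rewrite big_cons/=; have := ler_norm (F t - F s); have := ler_wpM2l e0 st; lra.
Qed.

(** Every time [c] has a neighbourhood in which all intervals around [c] are allowed
   steps. So the supremum of the times that chains reach is reached, by a step
   that ends at it, and is the last time, as otherwise a step that begins at it
   would lead further. *)
Lemma chain_exists (T : R) : 0 <= T ->
  (forall c, 0 <= c <= T -> exists2 d : R, 0 < d &
    forall s t : R, c - d < s -> s <= c -> c <= t -> t < c + d -> 0 <= s -> t <= T ->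
      F t - F s <= e * (t - s) \/ `]s, t[ `<=` U) ->
  exists l, chain T l.
Proof.
move=> T0 loc; pose G := [set t : R | 0 <= t <= T /\ exists l, chain t l].
have G0 : G 0 by split; [rewrite lexx T0 | exists [::]; exact: chain0].
have supG : has_sup G by split; [exists 0 | exists T => t [/andP[]]].
have step (s t : R) : G s -> s <= t -> t <= T ->
    F t - F s <= e * (t - s) \/ `]s, t[ `<=` U -> G t.
  move=> [/andP[s0 sT] [l cl]] st tT; split; first by rewrite tT (le_trans s0).
  by case: H => h; [exists l; exact: (chain_good cl)|exists ((s, t) :: l); exact: chain_bad].
set c := sup G.
have c0 : 0 <= c by apply: (sup_upper_bound supG).
have cT : c <= T by apply: ge_sup; [exists 0 | move=> t [/andP[]]].
have [|d d0 dP] := loc c; first by rewrite c0.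
have [s Gs cs] := sup_adherent d0 supG.
have sc : s <= c by apply: (sup_upper_bound supG).
have s0 : 0 <= s by case: Gs => /andP[].
have Gc : G c by apply: (step s) => //; apply: dP => //; lra.
have [cT'|] := ltP c T; last first.
  move=> Tc; have <- : c = T by apply/eqP; rewrite eq_le cT.
  by case: Gc.
pose t := Num.min T (c + d / 2).
have ct : c < t by rewrite /t lt_min cT' ltrDl divr_gt0.
have td : t < c + d by rewrite /t gt_min ltrD2l ltr_pdivrMr// ltr_pMr// ltr1n orbT.
have tT : t <= T by rewrite /t ge_min lexx.
have : G t by apply: (step c) => //; [exact: ltW | apply: dP => //; lra].
by move=> /(sup_upper_bound supG); rewrite leNgt ct.
Qed.

End chains.

(** The exceptional set has an open cover [U] of small measure, on which absolute
   continuity makes the total increment of [F] small; elsewhere, the sign of the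
   derivative bounds the slope of [F] on all small intervals around the point.
   The end points join the exceptional set. *)
Lemma ac_nonincreasing (F : R -> R) (T : R) (N : set R) :
  0 <= T -> absolutely_continuous T F -> mu.-negligible N ->
  (forall t, 0 < t < T -> ~ N t -> derivable F t 1 /\ derive1 F t <= 0) ->
  F T <= F 0.
Proof.
move=> T0 acF negN dF; apply/ler_addgt0Pr => e e0.
pose e1 := e / (T + 1).
have e10 : 0 < e1 by rewrite divr_gt0// ltr_wpDl.
have [d d0 dP] := acF e1 e10.
have neg2 : mu.-negligible (N `|` [set 0; T]).
  apply: negligibleU => //; apply: countable_negligible.
  by apply: finite_set_countable; exact: finite_set2.
have [U [oU NU Ud]] := null_cover neg2 d0.
have loc c : 0 <= c <= T -> exists2 d : R, 0 < d &
    forall s t : R, c - d < s -> s <= c -> c <= t -> t < c + d -> 0 <= s -> t <= T ->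
      F t - F s <= e1 * (t - s) \/ `]s, t[ `<=` U.
  move=> /andP[c0 cT]; have [Nc|Nc] := pselect ((N `|` [set 0; T]) c).
    have [b /= b0 bU] := open_nbhs_nbhs (conj oU (NU _ Nc)).
    exists b => // s t cs sc ct tc _ _; right => x /=; rewrite in_itv/= => /andP[sx xt].
    by apply: bU => /=; rewrite ltr_norml; apply/andP; split; lra.
  have c0T : 0 < c < T.
    rewrite !lt_neqAle c0 cT !andbT; apply/andP; split; apply/eqP => h; apply: Nc; right.
      by left.
    by right.
  have [|df dle] := dF c c0T; first by move=> Nc'; apply: Nc; left.
  have := df; rewrite /derivable => /cvgrPdist_le /(_ _ e10) [b /= b0 bP].
  have q h : h != 0 -> `|h| < b -> h^-1 * (F (h + c) - F c) <= e1.
    move=> hn hb; have := bP h; rewrite /= sub0r normrN => /(_ hb hn).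
    rewrite /GRing.scale/= mulr1.
    have -> : lim ((h^-1 * (F (h * 1 + c) - F c)) @[h --> 0^']) = derive1 F c.
      by rewrite derive1E.
    by rewrite ler_norml => /andP[]; lra.
  exists b => // s t cs sc ct tc _ _; left.
  have u1 : F t - F c <= e1 * (t - c).
    have [->|tc0] := eqVneq t c; first by rewrite !subrr mulr0.
    have tc1 : 0 < t - c by rewrite subr_gt0 lt_neqAle eq_sym tc0.
    have := q (t - c); rewrite gt_eqF// => /(_ isT); rewrite gtr0_norm// subrK.
    have tb : t - c < b by lra.
    by move=> /(_ tb); rewrite ler_pdivrMl// mulrC.
  have u2 : F c - F s <= e1 * (c - s).
    have [->|tc0] := eqVneq s c; first by rewrite !subrr mulr0.
    have tc1 : s - c < 0 by rewrite subr_lt0 lt_neqAle tc0.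
    have := q (s - c); rewrite lt_eqF// => /(_ isT); rewrite ltr0_norm// subrK.
    have tb : - (s - c) < b by lra.
    move=> /(_ tb); rewrite ler_ndivrMl//; lra.
  by lra.
have [l [pl dl ml Fl]] := chain_exists oU (ltW e10) T0 loc.
have sl : \sum_(p <- l) (p.2 - p.1) < d.
  rewrite -lte_fin (le_lt_trans ml)// (le_lt_trans _ Ud)//.
  by apply: le_measure; rewrite ?inE//; [apply: measurableI => //|]; exact: open_measurable.
have ok (i : 'I_(size l)) : [&& 0 <= (tnth (in_tuple l) i).1,
    (tnth (in_tuple l) i).1 <= (tnth (in_tuple l) i).2
    & (tnth (in_tuple l) i).2 <= T].
  by apply: (allP pl); rewrite -[X in _ \in X](in_tupleE l) mem_tnth.
have : \sum_(p <- l) `|F p.2 - F p.1| < e1.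
  rewrite big_tnth; apply: dP.
  - by move=> i; have /and3P[] := ok i.
  - move=> i j _ _ [x []]; rewrite /= !in_itv/= => /andP[ix xi] /andP[jx xj].
    have sep (p q : 'I_(size l)) : (p < q)%N ->
        (tnth (in_tuple l) q).2 <= (tnth (in_tuple l) p).1.
      move=> pq; rewrite !(tnth_nth (0, 0)) /=.
      by apply: (pairwiseP (0, 0) dl); rewrite ?inE ?ltn_ord.
    apply/val_inj => /=; case: (ltngtP i j) => // /sep ji; exfalso; lra.
  - by move: sl; rewrite big_tnth.
move=> Fl2; have : F T - F 0 <= e1 * (T + 1) by lra.
have -> : e1 * (T + 1) = e by rewrite /e1 divfK// gt_eqF// ltr_wpDl.
by lra.
Qed.

End absolutely_continuous.

(** * The normal component along a differentiable motion *)

Section velocity_normal.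
Context {R : realType} {H : normedModType R}.
Variables (dot : {dot H for idfun}) (hdot : induces_norm dot).
Implicit Types (C : set H) (x v c : H).

Lemma prox_normalP C x v : prox_normal_cone C x v <->
  C x /\ exists2 K : R, 0 < K &
    forall c, C c -> dot v (c - x) <= K * `|c - x| ^+ 2.
Proof.
split=> [[s s0 P]|[Cx [K K0 P]]].
  have Cx : C x by case: P.
  split => //; exists (2 * s)^-1; first by rewrite invr_gt0 mulr_gt0.
  by apply/(proj_normal hdot).
have K2 : 0 < 2 * K by rewrite mulr_gt0.
exists (2 * K)^-1; first by rewrite invr_gt0.
apply/(proj_normal hdot) => //; first by rewrite invr_gt0.
move=> c /P; rewrite (_ : (2 * (2 * K)^-1)^-1 = K)//.
by field; rewrite gt_eqF.
Qed.

(** A differentiable path in [C] has a velocity orthogonal to the proximal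
   normal [v x - p], so the metric projections of [x + h v(x)] leave [x] with
   the same velocity [p] as the path; the uniform inequality that directional
   prox-regularity grants to these projections then passes to the limit. *)
Lemma velocity_normal_bound C (v : H -> H) (r t : R) (w : R -> H) (p : H) :
  0 < r -> dir_prox_regular r v C ->
  (\forall s \near t, C (w s)) ->
  h^-1 *: (w (h + t) - w t) @[h --> 0^'] --> p ->
  prox_normal_cone C (w t) (v (w t) - p) ->
  forall c, C c -> dot (v (w t) - p) (c - w t) <=
    `|v (w t)| / (2 * r) * `|c - w t| ^+ 2.
Proof.
move=> r0 reg Cw wp /prox_normalP[Cx [K K0 nK]] c Cc.
set x := w t in wp Cx nK *; set G := v x in nK *; set n := G - p in nK *.
pose D h := h^-1 *: (w (h + t) - x).
have Dp : D h @[h --> 0^'+] --> p by exact: cvg_dnbhs_at_right.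
have Dn : D (- h) @[h --> 0^'+] --> p.
  by have := cvg_dnbhs_at_left wp; rewrite cvg_at_leftNP oppr0.
have nearC : \forall h \near 0^'+, [/\ 0 < h, h * `|G| < r, C (w (h + t)) & C (w (- h + t))].
  have /nbhs_ballP[d /= d0 dP] := Cw.
  have G1 : 0 < `|G| + 1 by rewrite ltr_wpDl.
  near=> h; have h0 : 0 < h by near: h; exact: nbhs_right_gt.
  have hd : h < d by near: h; exact: nbhs_right_lt.
  have hr : h < r / (`|G| + 1) by near: h; apply: nbhs_right_lt; rewrite divr_gt0.
  split => //.
  - by move: hr; rewrite ltr_pdivlMr//; lra.
  - by apply: dP; rewrite -ball_normE /= opprD addrCA subrr addr0 normrN gtr0_norm.
  - by apply: dP; rewrite -ball_normE /= opprD opprK addrCA subrr addr0 gtr0_norm.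
(* Backward difference quotients are tangent to [C] as well. *)
have np : 0 <= dot n p.
  have lhs : - (K * h * `|D (- h)| ^+ 2) @[h --> 0^'+] --> - (K * 0 * `|p| ^+ 2).
    have dn : `|D (- h)| @[h --> 0^'+] --> `|p| by exact: cvg_norm.
    apply: cvgN; apply: cvgM; last exact: (cvgM dn dn).
    by apply: cvgM; [exact: cvg_cst | exact: cvg_at_right_filter].
  rewrite mulr0 mul0r oppr0 in lhs.
  have rhs : dot n (D (- h)) @[h --> 0^'+] --> dot n p.
    by apply: (cvg_dot hdot) => //; exact: cvg_cst.
  apply: (ler_cvg_to lhs rhs); apply: filterS nearC => h [h0 _ _ Ch].
  have := nK _ Ch; have -> : w (- h + t) - x = - h *: D (- h).
    by rewrite /D scalerA divff ?scale1r// oppr_eq0 gt_eqF.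
  rewrite normrZ dotZr normrN gtr0_norm// => ev.
  have : h * - (K * h * `|D (- h)| ^+ 2) <= h * dot n (D (- h)) by lra.
  by rewrite ler_pM2l.
(* [G - q h] is not longer than [G - D h], which tends to [n]; as [dot n (q h)] has
   a small upper bound and [dot n p] is nonnegative, [q h] must tend to [p]. *)
pose z h := catch_up C v h x; pose q h := h^-1 *: (z h - x).
have spec h : 0 < h -> h * `|G| < r -> C (w (h + t)) ->
  [/\ `|p - q h| ^+ 2 <= 8 * K * `|G| ^+ 2 * h + (`|G - D h| ^+ 2 - `|n| ^+ 2),
    z h = x + h *: q h &
    dot (G - q h) (c - z h) <= `|G| / (2 * r) * `|c - z h| ^+ 2].
  move=> h0 hr Ch; have [Cz nz pz] := catch_upP hdot r0 reg Cx h0 hr.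
  have zq : z h = x + h *: q h.
    by rewrite /q scalerA divff ?scale1r ?gt_eqF// subrKC.
  have zx : z h - x = h *: q h by rewrite zq addrAC subrr add0r.
  have wD : w (h + t) = x + h *: D h.
    by rewrite /D scalerA divff ?scale1r ?gt_eqF// subrKC.
  have sh (y : H) : x + h *: G - (x + h *: y) = h *: (G - y).
    by apply: (dot_inj hdot) => u; rewrite !dotE; ring.
  have n1 : `|G - q h| <= `|G|.
    have := nz _ Cx; rewrite -/(z h) -/G {1}zq sh.
    rewrite (addrAC x) subrr add0r !normrZ (gtr0_norm h0) ler_pM2l//.
  have n2 : `|G - q h| <= `|G - D h|.
    by have := nz _ Ch; rewrite -/(z h) -/G zq wD !sh !normrZ (gtr0_norm h0) ler_pM2l.
  have n3 : dot (G - q h) (c - z h) <= `|G| / (2 * r) * `|c - z h| ^+ 2.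
    by have := pz _ Cc; rewrite -/(z h) -/G {1}zq sh dotZl -mulrA ler_pM2l.
  have n4 : dot n (q h) <= K * h * `|q h| ^+ 2.
    have := nK _ Cz; rewrite zx dotZr normrZ (gtr0_norm h0) exprMn => n4.
    have : h * dot n (q h) <= h * (K * h * `|q h| ^+ 2) by lra.
    by rewrite ler_pM2l.
  split => //.
  have q2 : `|q h| ^+ 2 <= (2 * `|G|) ^+ 2.
    rewrite lerXn2r ?nnegrE ?mulr_ge0//.
    have := ler_normB G (G - q h); rewrite opprB addrC subrK; lra.
  have n22 : `|G - q h| ^+ 2 <= `|G - D h| ^+ 2 by rewrite lerXn2r ?nnegrE.
  have := ler_wpM2l (mulr_ge0 (ltW K0) (ltW h0)) q2.
  have := sqr_normD hdot n (p - q h); rewrite subrKA => e.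
  by move: n22; rewrite e dotBr; lra.
have qp : q h @[h --> 0^'+] --> p.
  have rhs : 8 * K * `|G| ^+ 2 * h + (`|G - D h| ^+ 2 - `|n| ^+ 2) @[h --> 0^'+] -->
      8 * K * `|G| ^+ 2 * 0 + (`|G - p| ^+ 2 - `|n| ^+ 2).
    have dn : `|G - D h| @[h --> 0^'+] --> `|G - p|.
      by apply: cvg_norm; apply: cvgB => //; exact: cvg_cst.
    apply: cvgD; last by apply: cvgB; [exact: (cvgM dn dn) | exact: cvg_cst].
    by apply: cvgM; [exact: cvg_cst | exact: cvg_at_right_filter].
  rewrite mulr0 add0r subrr in rhs.
  apply/cvgrPdist_le => e e0.
  have e20 : 0 < e ^+ 2 by rewrite exprn_gt0.
  have rn : \forall h \near 0^'+,
      `|8 * K * `|G| ^+ 2 * h + (`|G - D h| ^+ 2 - `|n| ^+ 2)| <= e ^+ 2.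
    exact: (cvgr0_norm_le _ rhs).
  apply: filterS (filterI nearC rn) => h [[h0 hr Ch _] rh].
  have [pq _ _] := spec h h0 hr Ch.
  have : `|p - q h| ^+ 2 <= e ^+ 2 by rewrite (le_trans pq)// (le_trans _ rh)// ler_norm.
  by rewrite ler_pXn2r ?nnegrE ?(ltW e0).
have zp : x + h *: q h @[h --> 0^'+] --> x + 0 *: p.
  by apply: cvgD; [exact: cvg_cst | apply: cvgZ => //; exact: cvg_at_right_filter].
rewrite scale0r addr0 in zp.
have cz : c - (x + h *: q h) @[h --> 0^'+] --> c - x.
  by apply: cvgB => //; exact: cvg_cst.
have lhs : dot (G - q h) (c - (x + h *: q h)) @[h --> 0^'+] --> dot n (c - x).
  by apply: (cvg_dot hdot) => //; apply: cvgB => //; exact: cvg_cst.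
have rhs : `|G| / (2 * r) * `|c - (x + h *: q h)| ^+ 2 @[h --> 0^'+] -->
    `|G| / (2 * r) * `|c - x| ^+ 2.
  have dn : `|c - (x + h *: q h)| @[h --> 0^'+] --> `|c - x| by exact: cvg_norm.
  by apply: cvgM; [exact: cvg_cst | exact: (cvgM dn dn)].
apply: (ler_cvg_to lhs rhs); apply: filterS nearC => h [h0 hr Ch _].
by have [_ <- ] := spec h h0 hr Ch.
Unshelve. all: by end_near. Qed.

End velocity_normal.

(** * Absolute continuity, difference quotients and the Gronwall inequality *)

Section absolute_continuity_facts.
Context {R : realType}.

Lemma ac_le (V : normedModType R) (u : R -> V) (S T : R) : S <= T ->
  absolutely_continuous T u -> absolutely_continuous S u.
Proof.
move=> ST acu e e0; have [d d0 dP] := acu e e0; exists d => // n a b ab.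
by apply: dP => i; have [? [? bS]] := ab i; split => //; split => //; exact: le_trans ST.
Qed.

Lemma ac_dominated (U V W : normedModType R) (T c : R) (u : R -> U) (w : R -> V)
    (F : R -> W) : 0 <= c ->
  absolutely_continuous T u -> absolutely_continuous T w ->
  (forall s t : R, 0 <= s -> s <= t -> t <= T ->
    `|F t - F s| <= c * (`|u t - u s| + `|w t - w s| + (t - s))) ->
  absolutely_continuous T F.
Proof.
move=> c0 acu acw Fuw e e0; pose e1 := e / (3 * c + 1).
have c1 : 0 < 3 * c + 1 by rewrite ltr_wpDl// mulr_ge0.
have e10 : 0 < e1 by rewrite divr_gt0.
have [d1 d10 d1P] := acu e1 e10; have [d2 d20 d2P] := acw e1 e10.
exists (Num.min e1 (Num.min d1 d2)); first by rewrite !lt_min e10 d10.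
move=> n a b ab dis; rewrite !lt_min => /and3P[s1 s2 s3].
have := d1P n a b ab dis s2; have := d2P n a b ab dis s3 => h2 h1.
have : \sum_(i < n) `|F (b i) - F (a i)| <=
    c * (\sum_(i < n) `|u (b i) - u (a i)| + \sum_(i < n) `|w (b i) - w (a i)| +
      \sum_(i < n) (b i - a i)).
  rewrite -!big_split mulr_sumr; apply: ler_sum => i _.
  by have [a0 [abi bT]] := ab i; exact: Fuw.
move/le_lt_trans; apply.
have : c * (\sum_(i < n) `|u (b i) - u (a i)| + \sum_(i < n) `|w (b i) - w (a i)| +
      \sum_(i < n) (b i - a i)) <= c * (3 * e1).
  by rewrite ler_wpM2l//; lra.
have : (3 * c + 1) * e1 = e by rewrite /e1 mulrC divfK// gt_eqF.
by lra.
Qed.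

Lemma ac_cst (V : normedModType R) (T : R) (x : V) :
  absolutely_continuous T (fun=> x).
Proof.
move=> e e0; exists 1 => // n a b _ _ _.
by rewrite big1// => i _; rewrite subrr normr0.
Qed.

Lemma ac_uniform (V : normedModType R) (T e : R) (u : R -> V) :
  absolutely_continuous T u -> 0 < e -> exists2 d : R, 0 < d &
    forall s t : R, 0 <= s -> s <= t -> t <= T -> t - s < d -> `|u t - u s| < e.
Proof.
move=> acu e0; have [d d0 dP] := acu e e0; exists d => // s t s0 st tT std.
have := dP 1%N (fun=> s) (fun=> t); rewrite !big_ord1; apply => //.
by move=> i j _ _ _; rewrite !ord1.
Qed.

(** Increments are less than [1] over times shorter than [d], and finitely many steps
   of length [d / 2] cover the interval. *)
Lemma ac_bounded (V : normedModType R) (T : R) (u : R -> V) :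
  absolutely_continuous T u -> exists B, forall t : R, 0 <= t <= T -> `|u t| <= B.
Proof.
move=> acu; have [d d0 dP] := ac_uniform acu ltr01.
have d20 : 0 < d / 2 by rewrite divr_gt0.
have bn (n : nat) t : 0 <= t -> t <= T -> t <= n%:R * (d / 2) -> `|u t - u 0| <= n%:R.
  elim: n t => [|n IH] t t0 tT.
    rewrite mul0r => t0'; have -> : t = 0 by apply/eqP; rewrite eq_le t0 t0'.
    by rewrite subrr normr0.
  rewrite time_succ => tn; pose s := Num.max 0 (t - d / 2).
  have s0 : 0 <= s by rewrite le_max lexx.
  have st : s <= t by rewrite ge_max t0/= gerBl ltW.
  have sn : s <= n%:R * (d / 2) by rewrite ge_max mulr_ge0 ?(ltW d20)//= lerBlDr.
  have ts : t - s < d.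
    have : t - d / 2 <= s by rewrite le_max lexx orbT.
    by lra.
  have := IH s s0 (le_trans st tT) sn; have := dP s t s0 st tT ts.
  have := ler_normD (u t - u s) (u s - u 0); rewrite subrKA -natr1; lra.
exists (`|u 0| + (Num.truncn (T / (d / 2))).+1%:R) => t /andP[t0 tT].
have tn : t <= (Num.truncn (T / (d / 2))).+1%:R * (d / 2).
  rewrite -ler_pdivrMr//; apply: (le_trans _ (ltW (truncnS_gt _))).
  by rewrite ler_pM2r ?invr_gt0.
have := bn _ t t0 tT tn; have := ler_normD (u t - u 0) (u 0).
by rewrite subrK; lra.
Qed.

(** Multiplying by [expR (- Lam * t)] turns the differential inequality into
   monotonicity. *)
Lemma ac_gronwall (T Lam : R) (psi : R -> R) (N : set R) :
  0 <= T -> 0 <= Lam -> absolutely_continuous T psi ->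
  (@lebesgue_measure R).-negligible N ->
  (forall t, 0 < t < T -> ~ N t -> derivable psi t 1 /\ derive1 psi t <= Lam * psi t) ->
  psi 0 <= 0 -> psi T <= 0.
Proof.
move=> T0 Lam0 acpsi negN dpsi psi0.
have [B psiB] := ac_bounded acpsi.
have B0 : 0 <= B by rewrite (le_trans (normr_ge0 (psi 0)))// psiB// lexx.
pose E (t : R) : R := expR (- Lam * t).
pose F : R -> R := E * psi.
have FE s : F s = E s * psi s by [].
have Egt0 t : 0 < E t by exact: expR_gt0.
have acF : absolutely_continuous T F.
  apply: (ac_dominated (c := 1 + B * Lam) _ acpsi acpsi).
    exact: (addr_ge0 ler01 (mulr_ge0 B0 Lam0)).
  move=> s t s0 st tT.
  have t0 : 0 <= t := le_trans s0 st; have sT : s <= T := le_trans st tT.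
  have Bs : `|psi s| <= B by apply: psiB; rewrite s0.
  have Et : E t <= 1 by rewrite /E -expR0 ler_expR mulNr oppr_le0 mulr_ge0.
  have Es : E s <= 1 by rewrite /E -expR0 ler_expR mulNr oppr_le0 mulr_ge0.
  have Ed : `|E t - E s| <= Lam * (t - s).
    have -> : E t = E s * expR (- (Lam * (t - s))).
      by rewrite /E -expRD; congr expR; ring.
    have := expR_ge1Dx (- (Lam * (t - s))).
    have : expR (- (Lam * (t - s))) <= 1.
      by rewrite -expR0 ler_expR oppr_le0 mulr_ge0// subr_ge0.
    move: (expR _) => x x1 x2.
    have -> : E s * x - E s = - (E s * (1 - x)) by ring.
    rewrite normrN ger0_norm; last by rewrite mulr_ge0 ?expR_ge0// subr_ge0.
    by rewrite (le_trans (ler_wpM2r _ Es)) ?subr_ge0//; lra.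
  have -> : F t - F s = E t * (psi t - psi s) + psi s * (E t - E s).
    by rewrite !FE; ring.
  rewrite (le_trans (ler_normD _ _))// !normrM (ger0_norm (ltW (Egt0 t))).
  have h1 := ler_wpM2r (normr_ge0 (psi t - psi s)) Et.
  have h2 := ler_pM (normr_ge0 _) (normr_ge0 _) Bs Ed.
  have h3 := mulr_ge0 (mulr_ge0 B0 Lam0) (normr_ge0 (psi t - psi s)).
  have h4 := normr_ge0 (psi t - psi s).
  have h5 : 0 <= t - s by rewrite subr_ge0.
  by lra.
have F0 : F 0 <= 0 by rewrite FE pmulr_rle0.
suff : F T <= F 0 by move=> /le_trans/(_ F0); rewrite FE pmulr_rle0.
apply: (ac_nonincreasing T0 acF negN) => t tT Nt.
have [dp pl] := dpsi t tT Nt.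
have dE : is_derive t 1 E (- Lam * E t).
  have dl : is_derive t 1 (fun s : R => - Lam * s) (- Lam).
    by apply: is_derive_eq; rewrite scaler1.
  by rewrite mulrC; exact: (is_derive1_comp (is_derive_expR _) dl).
have dp' : is_derive t 1 psi (derive1 psi t) by apply: DeriveDef => //; rewrite derive1E.
have dF : is_derive t 1 F _ := is_deriveM dE dp'.
split; first by case: dF.
rewrite derive1E derive_val /GRing.scale/=.
by have := ler_wpM2l (ltW (Egt0 t)) pl; lra.
Qed.

End absolute_continuity_facts.

Section quotients.
Context {R : realType} {H : normedModType R}.
Implicit Types (w : R -> H) (t : R) (p : H).

Let quotE w t : (fun h : R => h^-1 *: ((w \o shift t) (h *: 1) - w t)) =
  (fun h : R => h^-1 *: (w (h + t) - w t)).
Proof. by apply/funext => h; rewrite /= /GRing.scale/= mulr1. Qed.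

Lemma derivable_quotient w t : derivable w t 1 ->
  h^-1 *: (w (h + t) - w t) @[h --> 0^'] --> derive1 w t.
Proof. by rewrite /derivable quotE. Qed.

Lemma quotient_derivable w t p :
  h^-1 *: (w (h + t) - w t) @[h --> 0^'] --> p ->
  derivable w t 1 /\ derive1 w t = p.
Proof.
move=> wp; split; last by rewrite /derive1; exact: cvg_lim.
by rewrite /derivable quotE; apply/cvg_ex; exists p.
Qed.

Lemma quotient_cvg_shift w t p (a : H) :
  h^-1 *: (w (h + t) - w t) @[h --> 0^'] --> p ->
  h^-1 *: ((w (h + t) + (h + t) *: a) - (w t + t *: a)) @[h --> 0^'] --> p + a.
Proof.
move=> wp; have : h^-1 *: (w (h + t) - w t) + a @[h --> 0^'] --> p + a.
  by apply: cvgD => //; exact: cvg_cst.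
apply: cvg_trans; apply: near_eq_cvg; near=> h.
have h0 : h != 0 by near: h; exact: nbhs_dnbhs_neq.
rewrite scalerDl opprD addrACA addrK (scalerDr _ (w (h + t) - w t)) scalerA.
by rewrite mulVf// scale1r.
Unshelve. all: by end_near. Qed.

End quotients.

Section squared_distance.
Context {R : realType} {H : normedModType R}.
Variables (dot : {dot H for idfun}) (hdot : induces_norm dot).
Implicit Types (u w : R -> H) (t T : R).

Lemma ac_sqr_dist u w T :
  absolutely_continuous T u -> absolutely_continuous T w ->
  absolutely_continuous T (fun t => `|u t - w t| ^+ 2 : R).
Proof.
move=> acu acw; have [Bu uB] := ac_bounded acu; have [Bw wB] := ac_bounded acw.
pose W := Num.max 0 (Bu + Bw).
have W0 : 0 <= W by rewrite le_max lexx.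
have dW t : 0 <= t -> t <= T -> `|u t - w t| <= W.
  move=> t0 tT; rewrite (le_trans (ler_normB _ _))// /W le_max; apply/orP; right.
  by rewrite lerD ?uB ?wB ?t0.
apply: (ac_dominated (c := 2 * W) _ acu acw); first by rewrite mulr_ge0.
move=> s t s0 st tT; have ds := dW s s0 (le_trans st tT).
have dt := dW t (le_trans s0 st) tT.
have tri : `| `|u t - w t| - `|u s - w s| | <= `|u t - u s| + `|w t - w s|.
  rewrite (le_trans (ler_dist_dist _ _))//.
  have -> : u t - w t - (u s - w s) = (u t - u s) - (w t - w s).
    by apply: (dot_inj hdot) => z; rewrite !dotE; ring.
  exact: ler_normB.
have le1 : `| `|u t - w t| ^+ 2 - `|u s - w s| ^+ 2 | <=
    2 * W * (`|u t - u s| + `|w t - w s|).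
  rewrite subr_sqr normrM mulrC ler_pM// ger0_norm ?addr_ge0//.
  by rewrite mulr_natl mulr2n lerD.
apply: (le_trans le1); rewrite ler_wpM2l ?mulr_ge0//.
by rewrite lerDl subr_ge0.
Qed.

Lemma derive_sqr_dist u w t : derivable u t 1 -> derivable w t 1 ->
  derivable (fun s => `|u s - w s| ^+ 2 : R) t 1 /\
  derive1 (fun s => `|u s - w s| ^+ 2 : R) t =
    2 * dot (derive1 u t - derive1 w t) (u t - w t).
Proof.
move=> du dw; set p := derive1 u t; set q := derive1 w t.
have dd : h^-1 *: ((u (h + t) - w (h + t)) - (u t - w t)) @[h --> 0^'] --> p - q.
  have -> : (fun h => h^-1 *: ((u (h + t) - w (h + t)) - (u t - w t))) =
    (fun h => h^-1 *: (u (h + t) - u t) - h^-1 *: (w (h + t) - w t)).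
    by apply/funext => h; apply: (dot_inj hdot) => z; rewrite !dotE; ring.
  by apply: cvgB; exact: derivable_quotient.
have hc : h @[h --> (0 : R)^'] --> (0 : R).
  by apply: cvg_within_filter; exact: cvg_id.
have dc : u (h + t) - w (h + t) @[h --> 0^'] --> u t - w t.
  have : h *: (h^-1 *: ((u (h + t) - w (h + t)) - (u t - w t))) + (u t - w t)
      @[h --> 0^'] --> 0 *: (p - q) + (u t - w t).
    by apply: cvgD; [exact: cvgZ | exact: cvg_cst].
  rewrite scale0r add0r; apply: cvg_trans; apply: near_eq_cvg; near=> h.
  have h0 : h != 0 by near: h; exact: nbhs_dnbhs_neq.
  by rewrite scalerA divff// scale1r subrK.
apply: quotient_derivable.
have -> : 2 * dot (p - q) (u t - w t) =
  dot (p - q) ((u t - w t) + (u t - w t)) by rewrite !dotE; ring.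
have -> : (fun h : R => h^-1 *: (`|u (h + t) - w (h + t)| ^+ 2 - `|u t - w t| ^+ 2)) =
    (fun h : R => dot (h^-1 *: ((u (h + t) - w (h + t)) - (u t - w t)))
      ((u (h + t) - w (h + t)) + (u t - w t))).
  apply/funext => h; rewrite -!hdot.
  move: (u (h + t) - w (h + t)) (u t - w t) => x y.
  by rewrite !dotE (dotC dot y x) /GRing.scale/=; ring.
by apply: (cvg_dot hdot) => //; apply: cvgD => //; exact: cvg_cst.
Unshelve. all: by end_near. Qed.

End squared_distance.

(** * Uniqueness *)

Section solutions.
Context {R : realType} {H : normedModType R}.
Variables (dot : {dot H for idfun}) (hdot : induces_norm dot).
Variables (T r : R) (f : H -> H) (a u0 : H) (C0 : set H).
Hypotheses (T0 : 0 < T) (r0 : 0 < r) (C0cl : closed C0).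
Hypothesis reg : forall t : R, 0 <= t <= T ->
  dir_prox_regular r (fun x : H => f (x + t *: a) - a) C0.

Let C (t : R) : set H := translate C0 (t *: a).
Let mu := @lebesgue_measure R.

Lemma translate_prox_normal (A : set H) b x v :
  prox_normal_cone (translate A b) x v <-> prox_normal_cone A (x - b) v.
Proof.
split=> /(prox_normalP hdot)[Cx [K K0 P]]; apply/(prox_normalP hdot).
  split; first by case: Cx => y Ay <-; rewrite addrK.
  exists K => // c Ac; have := P (c + b); rewrite opprB addrA; apply.
  by exists c.
split; first by exists (x - b) => //; rewrite subrK.
exists K => // _ [c Ac <-]; have := P c Ac; rewrite opprB addrA.
by [].
Qed.

Let null_interval (N : set R) (s t : R) : mu.-negligible N -> s < t ->
  exists2 x, s < x < t & ~ N x.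
Proof.
move=> [A [mA A0 NA]] st; apply: contrapT => h.
have sub : `]s, t[ `<=` A.
  move=> x; rewrite /= in_itv/= => xst; apply: NA; apply: contrapT => Nx.
  by apply: h; exists x.
have : (mu `]s, t[ <= mu A)%E.
  by apply: le_measure; rewrite ?inE//; exact: measurable_itv.
rewrite A0 /mu lebesgue_measure_itv/= lte_fin st -EFinB lee_fin.
by rewrite leNgt subr_gt0 st.
Qed.

(** Proximal normals exist only at points of the set, so the inclusion places the
   solution in [C t] almost everywhere, hence at a dense set of times; continuity
   does the rest. *)
Lemma solution_mem w (t : R) : sweeping_solution T C f u0 w -> 0 <= t <= T ->
  C0 (w t - t *: a).
Proof.
move=> [acw [N [mN N0 aeN]] _] /andP[t0 tT]; apply: contrapT => nC.
have oC : open (~` C0) by rewrite openC.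
have /nbhs_ballP[e /= e0 eC] := open_nbhs_nbhs (conj oC nC).
have e20 : 0 < e / 2 by rewrite divr_gt0.
have [d d0 dP] := ac_uniform acw e20.
have a1 : 0 < 2 * (`|a| + 1) by rewrite mulr_gt0// ltr_wpDl.
pose eta := Num.min d (e / (2 * (`|a| + 1))).
have eta0 : 0 < eta by rewrite lt_min d0 divr_gt0.
have negN : mu.-negligible N by exists N; split.
have st : Num.max 0 (t - eta) < Num.min T (t + eta).
  have p1 : 0 < t + eta by rewrite ltr_wpDl.
  have p2 : t - eta < T by rewrite ltrBlDr (le_lt_trans tT)// ltrDl.
  have p3 : t - eta < t + eta by rewrite ltrBlDr -addrA ltrDl addr_gt0.
  by rewrite gt_max !lt_min T0 p1 p2 p3.
have [x] := null_interval negN st.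
rewrite gt_max lt_min => /andP[/andP[x0 tx] /andP[xT xt]] Nx.
have xI : `[0, T]%classic x by rewrite /= in_itv/= !ltW.
have [_ [s s0 [Cx _]]] : derivable w x 1 /\
    prox_normal_cone (C x) (w x) (f (w x) - derive1 w x).
  by apply: contrapT => h; apply: Nx; apply: aeN => /= /(_ xI).
apply: (eC (w x - x *: a)); last first.
  by case: Cx => y Cy <-; rewrite addrK.
rewrite -ball_normE /=.
have -> : w t - t *: a - (w x - x *: a) = (w t - w x) - (t - x) *: a.
  by apply: (dot_inj hdot) => u; rewrite !dotE; ring.
apply: (le_lt_trans (ler_normB _ _)); rewrite normrZ.
have wd : `|w t - w x| < e / 2.
  have ed : eta <= d by rewrite ge_min lexx.
  have [tx'|/ltW xt'] := leP t x.
    by rewrite distrC; apply: dP => //; [exact: ltW | lra].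
  by apply: dP => //; [exact: ltW | lra].
have td : `|t - x| <= e / (2 * (`|a| + 1)).
  have ed : eta <= e / (2 * (`|a| + 1)) by rewrite ge_min lexx orbT.
  by rewrite (le_trans _ ed)// ler_norml; apply/andP; split; lra.
move: td; rewrite ler_pdivlMr// => td.
by have := normr_ge0 (t - x); lra.
Qed.

(** This is [velocity_normal_bound] in the frame in which the constraint is [C0]:
   there the force and the velocity both lose [a], and the defect is the same. *)
Lemma solution_normal w : sweeping_solution T C f u0 w ->
  exists2 N : set R, mu.-negligible N & forall t : R, 0 < t < T -> ~ N t ->
    derivable w t 1 /\ forall c, C0 c ->
      dot (f (w t) - derive1 w t) (c - (w t - t *: a)) <=
      `|f (w t) - a| / (2 * r) * `|c - (w t - t *: a)| ^+ 2.
Proof.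
move=> solw; have [_ aeN _] := solw; eexists; first exact: aeN.
move=> t /andP[t0 tT] /contrapT.
have tI : `[0, T]%classic t by rewrite /= in_itv/= !ltW.
move=> /(_ tI)[dw nw]; split => // c Cc.
pose om s := w s + s *: - a.
have omE s : om s = w s - s *: a by rewrite /om scalerN.
have tT' : 0 <= t <= T by rewrite !ltW.
have := quotient_cvg_shift (a := - a) (derivable_quotient dw) => dom.
have defect : f (w t - t *: a + t *: a) - a - (derive1 w t - a) = f (w t) - derive1 w t.
  by rewrite subrK opprB addrA subrK.
have near_mem : \forall s \near t, C0 (om s).
  near=> s; rewrite omE; apply: solution_mem solw _.
  apply/andP; split.
    by near: s; apply: filterS (lt_nbhsr t0) => s /ltW.
  by near: s; apply: filterS (lt_nbhsl tT) => s /ltW.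
have := @velocity_normal_bound _ _ _ hdot C0 _ r t om (derive1 w t - a) r0 (reg tT')
  near_mem dom.
rewrite omE defect subrK => vb.
by apply: vb Cc; exact/translate_prox_normal.
Unshelve. all: by end_near. Qed.

Variables (k : R).
Hypotheses (k0 : 0 <= k) (f_lip : forall x y, `|f x - f y| <= k * `|x - y|).

(** The inequality of [solution_normal] makes the normal components hypomonotone
   with the constant [B / r], so the squared distance of two solutions obeys a
   Gronwall inequality. *)
Lemma solution_unique u w : sweeping_solution T C f u0 u ->
  sweeping_solution T C f u0 w -> forall t : R, 0 <= t <= T -> w t = u t.
Proof.
move=> solu solw.
have [acu _ ui] := solu; have [acw _ wi] := solw.
have [Bu uB] := ac_bounded acu; have [Bw wB] := ac_bounded acw.
have [Nu negu nu] := solution_normal solu; have [Nw negw nw] := solution_normal solw.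
pose B := `|f 0| + `|a| + k * Num.max 0 (Num.max Bu Bw).
have fB x : `|x| <= Num.max Bu Bw -> `|f x - a| <= B.
  move=> xB; have := ler_normB (f x) a; have := ler_normD (f x - f 0) (f 0).
  rewrite subrK; have := f_lip x 0; rewrite subr0 => f1.
  have : k * `|x| <= k * Num.max 0 (Num.max Bu Bw).
    by rewrite ler_wpM2l// le_max xB orbT.
  by rewrite /B; lra.
have B0 : 0 <= B.
  by rewrite /B !addr_ge0// mulr_ge0// le_max lexx.
pose Lam := 2 * (k + B / r).
have Lam0 : 0 <= Lam by rewrite mulr_ge0// addr_ge0// divr_ge0// ltW.
pose psi (t : R) : R := `|u t - w t| ^+ 2.
have dpsi (t : R) : 0 < t < T -> ~ (Nu `|` Nw) t ->
    derivable psi t 1 /\ derive1 psi t <= Lam * psi t.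
  move=> tT /not_orP[Nut Nwt].
  have [du ru] := nu t tT Nut; have [dw rw] := nw t tT Nwt.
  have tT' : 0 <= t <= T by case/andP: tT => ? ?; rewrite !ltW.
  have [dp dpE] := derive_sqr_dist hdot du dw; split => //.
  have -> : derive1 psi t = 2 * dot (derive1 u t - derive1 w t) (u t - w t) := dpE.
  set p := derive1 u t in ru *; set q := derive1 w t in rw *.
  have := ru _ (solution_mem solw tT'); have := rw _ (solution_mem solu tT').
  have eu : w t - t *: a - (u t - t *: a) = w t - u t.
    by rewrite opprB addrA subrK.
  have ew : u t - t *: a - (w t - t *: a) = u t - w t.
    by rewrite opprB addrA subrK.
  rewrite eu ew => rwt rut; rewrite (distrC (w t)) in rut.
  have ut : `|f (u t) - a| <= B by apply: fB; rewrite le_max uB.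
  have wt : `|f (w t) - a| <= B by apply: fB; rewrite le_max wB ?orbT.
  have r20 : 0 <= (2 * r)^-1 by rewrite invr_ge0 mulr_ge0 ?(ltW r0).
  have psi0 : 0 <= psi t by rewrite /psi sqr_ge0.
  have ru' := ler_wpM2r psi0 (ler_wpM2r r20 ut).
  have rw' := ler_wpM2r psi0 (ler_wpM2r r20 wt).
  have fl : dot (f (u t) - f (w t)) (u t - w t) <= k * psi t.
    by rewrite (le_trans (dot_le hdot _ _))// /psi expr2 mulrA ler_wpM2r.
  have e2 : B / (2 * r) = B / r / 2 by field; rewrite gt_eqF.
  rewrite -/(psi t) in rwt rut.
  (* The derivatives differ by the forces minus the two proximal normals, each
     of which is tested against the position of the other solution. *)
  have : dot (p - q) (u t - w t) = dot (f (u t) - f (w t)) (u t - w t) +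
      dot (f (u t) - p) (w t - u t) + dot (f (w t) - q) (u t - w t).
    by rewrite !dotE; ring.
  by rewrite /Lam; rewrite e2 in ru' rw'; lra.
move=> t /andP[t0 tT].
have : psi t <= 0.
  apply: (ac_gronwall t0 Lam0 (ac_le tT (ac_sqr_dist hdot acu acw))
    (negligibleU negu negw)); last by rewrite /psi ui wi subrr normr0 expr0n.
  by move=> s /andP[s0 st]; apply: dpsi; rewrite s0 (lt_le_trans st).
move=> h; apply/esym/subr0_eq/normr0_eq0/eqP.
by rewrite -sqrf_eq0 eq_le h sqr_ge0.
Qed.

End solutions.

(** * Existence *)

Section existence.
Context {R : realType} {H : completeNormedModType R}.
Variables (dot : {dot H for idfun}) (hdot : induces_norm dot).
Variables (T r k : R) (f : H -> H) (a u0 : H) (C0 : set H).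
Hypotheses (T0 : 0 <= T) (r0 : 0 < r) (k0 : 0 < k) (C0cl : closed C0) (Cu0 : C0 u0).
Hypothesis f_lip : forall x y, `|f x - f y| <= k * `|x - y|.
Hypothesis reg : forall t : R, 0 <= t <= T ->
  dir_prox_regular r (fun x : H => f (x + t *: a) - a) C0.

Let clamp (t : R) : R := Num.max 0 (Num.min t T).

Let clampP (t : R) : 0 <= clamp t <= T.
Proof. by rewrite /clamp le_max lexx/= ge_max T0/= ge_min lexx orbT. Qed.

Let clamp_id (t : R) : 0 <= t <= T -> clamp t = t.
Proof. by move=> /andP[t0 tT]; rewrite /clamp min_l// max_r. Qed.

Let clamp_lip (s t : R) : `|clamp t - clamp s| <= `|t - s|.
Proof.
wlog st : s t / s <= t.
  by move=> h; have [/h//|/ltW/h] := leP s t; rewrite distrC (distrC s).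
rewrite [leRHS]ger0_norm ?subr_ge0// ler_norml /clamp.
by case: (leP t T) => tT; case: (leP s T) => sT; case: (leP 0 t) => t0;
  case: (leP 0 s) => s0; case: (leP 0 T) => T0'; apply/andP; split; lra.
Qed.

(** The force in the frame in which the constraint is [C0]. Freezing it outside the
   time interval lets the motion go on after [T], so that right derivatives make
   sense up to [T]. *)
Let g (t : R) (x : H) : H := f (x + clamp t *: a) - a.

Let g_lip (s t : R) x y : `|g t x - g s y| <= k * (1 + `|a|) * (`|x - y| + `|t - s|).
Proof.
rewrite /g; have -> : f (x + clamp t *: a) - a - (f (y + clamp s *: a) - a) =
    f (x + clamp t *: a) - f (y + clamp s *: a).
  by rewrite opprB addrA subrK.
apply: (le_trans (f_lip _ _)); rewrite -mulrA ler_wpM2l ?(ltW k0)//.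
have -> : x + clamp t *: a - (y + clamp s *: a) = (x - y) + (clamp t - clamp s) *: a.
  by apply: (dot_inj hdot) => z; rewrite !dotE; ring.
rewrite (le_trans (ler_normD _ _))// normrZ.
have := ler_wpM2r (normr_ge0 a) (clamp_lip s t).
have := mulr_ge0 (normr_ge0 a) (normr_ge0 (x - y)).
by have := normr_ge0 (t - s); lra.
Qed.

(** The limit of the scheme, moved back by [t *: a]: it is differentiable off a
   countable set, and [right_deriv_evi] is the inequality of a proximal normal. *)
Lemma solution_exists : exists u : R -> H,
  sweeping_solution T (fun t : R => translate C0 (t *: a)) f u0 u /\
  forall t : R, 0 <= t <= T -> translate C0 (t *: a) (u t).
Proof.
have T1 : 0 < T + 1 by rewrite ltr_wpDl.
have ka : 0 < k * (1 + `|a|) by rewrite mulr_gt0// ltr_wpDr.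
have greg t : dir_prox_regular r (g t) C0 by exact: reg (clampP t).
have [L [K [b [v [L0 K0 b0 hv]]]]] :=
  sweeping_limit_exists hdot r0 ka T1 Cu0 C0cl greg g_lip.
have mem (t : R) : 0 <= t <= T -> translate C0 (t *: a) (v t + t *: a).
  move=> /andP[t0 tT]; exists (v t) => //; apply: (limit_mem hv).
  by rewrite t0 (le_trans tT)// lerDl.
exists (fun t => v t + t *: a); split => //; split.
- apply: (ac_dominated (c := L + `|a|) _ (ac_cst T (0 : H)) (ac_cst T (0 : H))).
    by rewrite addr_ge0.
  move=> s t s0 st tT; rewrite !subrr !normr0 !add0r.
  have -> : v t + t *: a - (v s + s *: a) = (v t - v s) + (t - s) *: a.
    by apply: (dot_inj hdot) => z; rewrite !dotE; ring.
  rewrite (le_trans (ler_normD _ _))// normrZ ger0_norm ?subr_ge0//.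
  have tS : t <= T + 1 by lra.
  by have := limit_lip hv s0 st tS; lra.
- have TS : T < T + 1 by lra.
  have [N cN dN] := differentiable_off_countable hdot L0 K0 b0 hv TS.
  have negN : (@lebesgue_measure R).-negligible (N `|` [set 0; T]).
    apply: negligibleU; apply: countable_negligible => //.
    by apply: finite_set_countable; exact: finite_set2.
  apply: negligibleS negN => t /= nP; apply: contrapT => nN; apply: nP => tI.
  have [t0' tT'] : 0 <= t /\ t <= T by move: tI; rewrite in_itv/= => /andP[].
  have tT : 0 < t < T.
    rewrite !lt_neqAle t0' tT' !andbT; apply/andP; split; apply/eqP => h; apply: nN; right.
      by left.
    by right.
  have Nt : ~ N t by move=> h; apply: nN; left.
  have [du ->] := quotient_derivable (w := fun t : R => v t + t *: a)
    (quotient_cvg_shift (w := v) (a := a) (dN t tT Nt)).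
  split => //; apply/(translate_prox_normal hdot); rewrite addrK.
  apply/(prox_normalP hdot); split.
    by apply: (limit_mem hv); rewrite t0' (le_trans tT')// lerDl.
  exists (K + 1); first by rewrite ltr_wpDl.
  move=> c Cc; have tS : t < T + 1 by lra.
  have := right_deriv_evi hdot L0 K0 b0 hv t0' tS Cc.
  rewrite /g clamp_id ?t0'// -addrA -opprD (addrC a) => /le_trans; apply.
  by rewrite ler_wpM2r ?sqr_ge0// lerDl.
- by rewrite (limit_init hv) scale0r addr0.
Qed.

End existence.

Lemma lipschitz_cst (R : realType) (H : normedModType R) (f : H -> H) :
  lipschitz f -> exists2 k : R, 0 < k & forall x y, `|f x - f y| <= k * `|x - y|.
Proof.
move=> [M [_ MP]]; exists (Num.max M 0 + 1).
  by rewrite ltr_wpDl// le_max lexx orbT.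
move=> x y; have := MP (Num.max M 0 + 1).
rewrite (le_lt_trans (_ : _ <= Num.max M 0)) ?le_max ?lexx// ?ltrDl// => /(_ isT).
by move=> /(_ (x, y)) /=; apply.
Qed.

Theorem theorem6p10 (R : realType) (H : completeNormedModType R)
    (dot : {dot H for idfun}) (hdot : induces_norm dot)
    (hsep : separable H)
    (T : R) (hT : 0 <= T) (r : R) (hr : 0 < r)
    (f : H -> H) (hlip : lipschitz f)
    (hgrowth : exists2 L : R, 0 < L & forall x : H, `|f x| <= L * (1 + `|x|))
    (a : H) (C0 : set H) (hC0 : C0 !=set0) (hclosed : closed C0)
    (hreg : forall t : R, `[0, T]%classic t ->
      dir_prox_regular r (fun x : H => f (x + t *: a) - a) C0)
    (u0 : H) (hu0 : C0 u0) :
  let C := fun t : R => translate C0 (t *: a) in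
  exists u : R -> H,
    [/\ sweeping_solution T C f u0 u,
        forall w : R -> H, sweeping_solution T C f u0 w ->
          forall t : R, `[0, T]%classic t -> w t = u t &
        forall t : R, `[0, T]%classic t -> C t (u t)].
Proof.
have [k k0 f_lip] := lipschitz_cst hlip.
have reg (t : R) : 0 <= t <= T ->
    dir_prox_regular r (fun x : H => f (x + t *: a) - a) C0.
  by move=> tT; apply: hreg.
have [u [solu Cu]] := solution_exists hdot hT hr k0 hclosed hu0 f_lip reg.
exists u; split => // w solw t; rewrite /= in_itv/= => tT.
have [Tp|T0] := ltP 0 T.
  exact: (solution_unique hdot Tp hr hclosed reg (ltW k0) f_lip solu solw tT).
have -> : t = 0 by case/andP: tT => t0 tT'; apply/eqP; rewrite eq_le t0; lra.
by case: solu => _ _ ->; case: solw.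
Qed.
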